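(* Let $\beta>1$ and let $\zeta\in\mathbb{C}\setminus\mathbb{R}$ with $|\zeta|=\beta$. Let $\mathcal{L}=\mathbb{Z}+(-\overline{\zeta})\mathbb{Z}$ and $\mathcal{X}=\{x+(-\overline{\zeta})y\mid x,y\in[0,1)\}$, and let $T_\zeta:\mathcal{X}\to\mathcal{X}$ be given by $T_\zeta(z)=\zeta z-d(z)$, where $d(z)$ is the unique element of $\mathcal{L}$ with $\zeta z\in\mathcal{X}+d(z)$. Let $\theta\in(0,\pi)$ be the angle between $1$ and $-\overline{\zeta}$, regarded as vectors in $\mathbb{C}\cong\mathbb{R}^2$, and put $$C(\theta)=\sqrt{\frac{1+\sqrt{1+4\sin^4(\theta)}}{2\sin^2(\theta)}}.$$ If $\beta>\max\{2,C(\theta)\}$, then $(\mathcal{X},T_\zeta)$ has a unique ACIM, and this ACIM is equivalent to the $2$-dimensional Lebesgue measure on $\mathcal{X}$.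
   Context: An ACIM of $(\mathcal{X},T_\zeta)$ is a $T_\zeta$-invariant Borel probability measure on $\mathcal{X}$ that is absolutely continuous with respect to $2$-dimensional Lebesgue measure on $\mathbb{C}\cong\mathbb{R}^2$. Equivalent means mutually absolutely continuous. *)

(* Defs.v *)
From mathcomp Require Import all_boot all_order all_algebra.
From mathcomp Require Import complex.
From mathcomp Require Import all_classical all_reals all_analysis.
From mathcomp Require Import ring lra.

Set Implicit Arguments.
Unset Strict Implicit.
Unset Printing Implicit Defensive.

Import Order.TTheory GRing.Theory Num.Theory.

Local Open Scope classical_set_scope.
Local Open Scope ring_scope.
Local Open Scope complex_scope.

Section complex_dynamics.
Variable R : realType.
Implicit Types (zeta u v z : R[i]).

Definition lattice zeta : set R[i] :=
  [set l | exists m n : int, l = m%:~R + (- conjc zeta) * n%:~R].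

Definition tile zeta : set R[i] :=
  [set z | exists x y : R,
     [/\ 0 <= x < 1, 0 <= y < 1 & z = x%:C + (- conjc zeta) * y%:C]].

(* The default value 0 is never used when zeta is not real: see digit_unique. *)
Definition digit zeta z : R[i] :=
  xget 0 [set l | lattice zeta l /\ tile zeta (zeta * z - l)].

Definition rotational_beta zeta z : R[i] := zeta * z - digit zeta z.

Definition angle u v : R :=
  acos ((complex.Re u * complex.Re v + complex.Im u * complex.Im v)
        / (complex.Re `|u| * complex.Re `|v|)).

Definition Cbound (theta : R) : R :=
  Num.sqrt ((1 + Num.sqrt (1 + 4 * sin theta ^+ 4)) / (2 * sin theta ^+ 2)).

(* The Borel structure on the complex numbers is that of the plane. *)
Definition plane := (measurableTypeR R * measurableTypeR R)%type.

Definition complex_of_plane (p : plane) : R[i] := p.1 +i* p.2.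

Definition in_plane (A : set R[i]) : set plane := complex_of_plane @^-1` A.

Definition lebesgue2 : {measure set plane -> \bar R} :=
  (lebesgue_measure \x lebesgue_measure)%E.

Definition lebesgue_tile zeta (A : set plane) : \bar R :=
  lebesgue2 (A `&` in_plane (tile zeta)).

(* A Borel probability measure on the tile is encoded as a Borel probability
   measure on the plane giving mass 1 to the tile; equality of two such measures
   is equality on the Borel sets. *)
Definition is_ACIM zeta (mu : probability plane R) :=
  [/\ mu (in_plane (tile zeta)) = 1%E,
      forall A : set R[i], A `<=` tile zeta -> measurable (in_plane A) ->
        mu (in_plane (tile zeta `&` rotational_beta zeta @^-1` A)) =
        mu (in_plane A)
    & mu `<< lebesgue2].

Lemma tile_coord zeta (x y : R) :
  x%:C + (- conjc zeta) * y%:C =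
  (x - complex.Re zeta * y) +i* (complex.Im zeta * y).
Proof.
case: zeta => a b; apply/eqP; rewrite eq_complex /=.
by apply/andP; split; apply/eqP; ring.
Qed.

Lemma lattice_coord zeta (m n : int) :
  m%:~R + (- conjc zeta) * n%:~R =
  (m%:~R - complex.Re zeta * n%:~R) +i* (complex.Im zeta * n%:~R) :> R[i].
Proof. by rewrite -tile_coord !rmorph_int. Qed.

Lemma digit_unique zeta z : complex.Im zeta != 0 ->
  exists! l, lattice zeta l /\ tile zeta (zeta * z - l).
Proof.
move=> b0; set w := zeta * z.
pose y := complex.Im w / complex.Im zeta.
pose x := complex.Re w + complex.Re zeta * y.
have wE : w = (x - complex.Re zeta * y) +i* (complex.Im zeta * y).
  apply/eqP; rewrite eq_complex /= /x addrK eqxx /=; apply/eqP.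
  by rewrite /y; field.
have fl (t : R) : 0 <= t - (Num.floor t)%:~R < 1.
  by rewrite subr_ge0 floor_le ltrBlDl -intrD1 floorD1_gt.
exists ((Num.floor x)%:~R + (- conjc zeta) * (Num.floor y)%:~R); split.
  split; first by exists (Num.floor x), (Num.floor y).
  exists (x - (Num.floor x)%:~R), (y - (Num.floor y)%:~R); split => //.
  rewrite wE lattice_coord tile_coord; apply/eqP; rewrite eq_complex /=.
  by apply/andP; split; apply/eqP; ring.
move=> l [[m [n ->]] [s [t [s01 t01]]]].
rewrite wE lattice_coord tile_coord => /eqP; rewrite eq_complex /=.
case/andP => /eqP e1 /eqP e2.
have {}e2 : y = t + n%:~R.
  by apply: (mulfI b0); rewrite mulrDr -e2; ring.
have {}e1 : x = s + m%:~R by move: e1; rewrite e2; lra.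
have -> : Num.floor x = m.
  by apply/eqP; rewrite floor_eq e1 intrD; lra.
have -> : Num.floor y = n.
  by apply/eqP; rewrite floor_eq e2 intrD; lra.
by rewrite lattice_coord.
Qed.

Lemma digitP zeta z : complex.Im zeta != 0 ->
  lattice zeta (digit zeta z) /\ tile zeta (rotational_beta zeta z).
Proof.
move=> b0; rewrite /rotational_beta /digit; case: xgetP => [l -> //|h].
by have [l [hl _]] := digit_unique z b0; case: (h l).
Qed.

End complex_dynamics.

(* Main.v *)
(** In the coordinates [z = x - conj(zeta) y] the map is
    [(x, y) |-> (2 Re(zeta) x - beta^2 y mod 1, x)], so each step expands
    conformally by [beta] and cuts along a single family of parallel lines.

    Existence.  For a probability [mu] consider the constants [K] such that
    [|mu (A + v) - mu A| <= K |v|] for all [A] and [v].  One step divides [K] by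
    [beta], the cut at most doubles it, and wrapping the strips costs [O(1)];
    since [beta > 2], all push-forwards of a uniform measure share one [K].
    Averaging over [v] turns such a bound into uniform absolute continuity, so an
    ultralimit of Cesaro means is sigma-additive and is an ACIM.

    Full support.  Let [C] be a forward invariant set of positive measure.  The
    same bound shows that for most [z] the iterate [T^n] is affine on a disc of
    radius [rho / beta^n] around [z]; blowing up near such points of [C] where
    translations barely change [C], and using compactness, [C] contains a disc
    up to a null set.  Discs grow by [beta / 2 > 1] until they fill a strip; the
    image of a disc inscribed in a strip contains the band
    [|y - 1/2| < sqrt (1 - 1 / Im(zeta)^2) / 2], whose image is the whole tile
    exactly when [beta^4 (1 - 1 / Im(zeta)^2) > 1], i.e. [beta > C(theta)].
    Hence every ACIM is equivalent to Lebesgue measure, and applying this to the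
    positive part of the difference of two ACIMs gives uniqueness. *)

Require Import Defs.
From HB Require Import structures.
From mathcomp Require Import all_boot all_order all_algebra.
From mathcomp Require Import complex.
From mathcomp Require Import all_classical all_reals all_analysis.
From mathcomp Require Import measurable_realfun.
From mathcomp Require Import ring lra.

Set Implicit Arguments.
Unset Strict Implicit.
Unset Printing Implicit Defensive.

Import Order.TTheory GRing.Theory Num.Theory numFieldNormedType.Exports.

Local Open Scope classical_set_scope.
Local Open Scope ring_scope.
Local Open Scope complex_scope.

(** * Planar Lebesgue measure *)

Definition image_measure d1 d2 (T1 : measurableType d1) (T2 : measurableType d2)
    (R : realType) (m : {measure set T1 -> \bar R}) (f : T1 -> T2)
    (mf : measurable_fun setT f) : {measure set T2 -> \bar R} :=
  measure_function_pushforward__canonical__measure_function_Measure m mf.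

Lemma image_measureE d1 d2 (T1 : measurableType d1) (T2 : measurableType d2)
    (R : realType) (m : {measure set T1 -> \bar R}) (f : T1 -> T2)
    (mf : measurable_fun setT f) (A : set T2) :
  image_measure m mf A = m (f @^-1` A).
Proof. by []. Qed.

Section plane_lebesgue.
Variable R : realType.
Local Notation plane := (plane R).
Local Notation leb := (@lebesgue_measure R).
Local Notation leb2 := (@lebesgue2 R).

(** The pushforward rescaled by [|d|] agrees with Lebesgue measure on half-open intervals, so
    uniqueness identifies them; the sign of [d] decides which end of the preimage interval is
    open. *)
Lemma lebesgue_measure_affine (c d : R) (A : set (measurableTypeR R)) : d != 0 ->
  measurable A ->
  leb ((fun y => c + d * y) @^-1` A) = (`|d|^-1%:E * leb A)%E.
Proof.
move=> d0 mA.
have mf : measurable_fun setT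
    (fun y : measurableTypeR R => c + d * y : measurableTypeR R).
  exact: measurable_funD.
have d_gt0 : 0 < `|d| by rewrite normr_gt0.
pose m : {measure set (measurableTypeR R) -> \bar R} :=
  mscale (NngNum (normr_ge0 d)) (image_measure leb mf).
have mE X : m X = (`|d|%:E * leb ((fun y => (c + d * y)%R) @^-1` X))%E by [].
suff H : forall X, ocitv X -> leb X = m X.
  rewrite (lebesgue_measure_unique H mA) mE muleA -EFinM.
  by rewrite mulVf ?gt_eqF// mul1e.
move=> X [[x y] _ <-]; rewrite mE.
have [d_pos|d_neg|/esym] := ltgtP 0 d; last by move/eqP; rewrite (negbTE d0).
- have -> : (fun y0 : R => c + d * y0) @^-1` `]x, y] =
      `](x - c) / d, (y - c) / d]%classic.
    apply/seteqP; split => z /=; rewrite !in_itv/= ltr_pdivrMr// ler_pdivlMr//;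
      by rewrite mulrC ltrBlDl lerBrDl mulrC.
  rewrite !lebesgue_measure_itv/= !lte_fin ltr_pM2r ?invr_gt0// ltrD2r.
  case: ifPn => _; last by rewrite mule0.
  by rewrite -!EFinB -EFinM gtr0_norm//; congr EFin; field.
- have -> : (fun y0 : R => c + d * y0) @^-1` `]x, y] =
      `[(y - c) / d, (x - c) / d[%classic.
    apply/seteqP; split => z /=; rewrite !in_itv/= ler_ndivrMr// ltr_ndivlMr//;
      by rewrite ltrBlDl lerBrDl mulrC andbC.
  rewrite !lebesgue_measure_itv/= !lte_fin ltr_nM2r ?invr_lt0// ltrD2r.
  case: ifPn => _; last by rewrite mule0.
  by rewrite -!EFinB -EFinM ltr0_norm//; congr EFin; field.
Qed.

(** Each vertical section is transformed affinely, with the same factor [d], so integrating over the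
    first coordinate gives the Jacobian. Translations and multiplication by zeta are composed below
    from such shears and the swap. *)
Lemma lebesgue2_shear (f : R -> R) (d : R) (A : set plane) : d != 0 ->
  measurable_fun setT f -> measurable A ->
  leb2 [set p | A (p.1, f p.1 + d * p.2)] = (`|d|^-1%:E * leb2 A)%E.
Proof.
move=> d0 mf mA.
have mg : measurable_fun setT (fun p : plane => (p.1, f p.1 + d * p.2) : plane).
  apply: measurable_fun_pair; first exact: measurable_fst.
  apply: measurable_funD; first exact: (measurableT_comp mf).
  by apply: measurable_funM.
have mx : measurable_fun setT (leb \o xsection A).
  exact: measurable_fun_xsection.
have d_ge0 : (0 <= `|d|^-1%:E :> \bar R)%E by rewrite lee_fin invr_ge0.
rewrite /lebesgue2 /product_measure1 -ge0_integralZl//.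
apply: eq_integral => x _ /=.
rewrite -(lebesgue_measure_affine (f x) d0 (measurable_xsection x mA)).
by congr leb; apply/seteqP; split => y; rewrite /xsection/= !inE.
Qed.

Lemma lebesgue2_swap (A : set plane) : measurable A ->
  leb2 [set p | A (p.2, p.1)] = leb2 A.
Proof.
move=> mA.
have ms : measurable_fun setT (fun p : plane => (p.2, p.1) : plane).
  exact: measurable_fun_pair.
apply/esym.
apply: (@product_measure_unique _ _ _ _ _ leb leb (image_measure leb2 ms)) => //.
move=> B C mB mC; rewrite muleC -product_measure1E// image_measureE.
congr (leb2 _); by apply/seteqP; split => -[x y] /= [].
Qed.

End plane_lebesgue.

Lemma fubini_sections d1 d2 (T1 : measurableType d1) (T2 : measurableType d2)
    (R : realType) (m1 : {sigma_finite_measure set T1 -> \bar R})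
    (m2 : {sigma_finite_measure set T2 -> \bar R}) (W : set (T1 * T2)) :
  measurable W ->
  (\int[m1]_x m2 (xsection W x) = \int[m2]_y m1 (ysection W y))%E.
Proof.
move=> mW; have := indic_fubini_tonelli m1 m2 mW.
by rewrite indic_fubini_tonelli_FE// indic_fubini_tonelli_GE.
Qed.

Lemma lebesgue2_sigma_finite (R : realType) : sigma_finite setT (@lebesgue2 R).
Proof.
have /sigma_finiteP[F [TF ndF Foo]] := sigma_finiteT (@lebesgue_measure R).
exists (fun n => F n `*` F n).
  rewrite -setXTT {1 2}TF predeqE => -[x y]; split.
    move=> [/= [n _ Fnx] [k _ Gky]]; exists (maxn n k) => //; split.
    - by move: x Fnx; exact/subsetPset/ndF/leq_maxl.
    - by move: y Gky; exact/subsetPset/ndF/leq_maxr.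
  by move=> [n _ []/= ? ?]; split; exists n.
move=> k; have [mF Fk] := Foo k.
split; first exact: measurableX.
by rewrite /lebesgue2/= product_measure1E// lte_mul_pinfty// ge0_fin_numE.
Qed.

(** A synonym of [lebesgue2] that carries a sigma-finite structure, so that Fubini applies to
    products having the plane as a factor. *)
Definition sigma_finite_lebesgue2 (R : realType) : set (plane R) -> \bar R :=
  @lebesgue2 R.

HB.instance Definition _ (R : realType) :=
  Measure.copy (@sigma_finite_lebesgue2 R) (@lebesgue2 R).

HB.instance Definition _ (R : realType) :=
  Measure_isSigmaFinite.Build _ _ _ (@sigma_finite_lebesgue2 R)
    (@lebesgue2_sigma_finite R).

(** * Translations of the plane *)

Section translations.
Variable R : realType.
Local Notation plane := (plane R).
Local Notation leb := (@lebesgue_measure R).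
Local Notation leb2 := (@lebesgue2 R).

Definition translate (v p : plane) : plane := (p.1 + v.1, p.2 + v.2).

Lemma measurable_translate v : measurable_fun setT (translate v).
Proof.
by apply: measurable_fun_pair; apply: measurable_funD.
Qed.

Lemma measurable_translate_preimage v A : measurable A ->
  measurable (translate v @^-1` A).
Proof. by move=> mA; rewrite -[X in measurable X]setTI; exact: measurable_translate. Qed.

Lemma translateC u v : translate u v = translate v u.
Proof. by rewrite /translate addrC (addrC u.2). Qed.

Lemma lebesgue2_translate v A : measurable A ->
  leb2 (translate v @^-1` A) = leb2 A.
Proof.
move=> mA.
have mB : measurable [set p : plane | A (p.1 + v.1, p.2)].
  rewrite -[X in measurable X]setTI.
  suff mf : measurable_fun setT (fun p : plane => (p.1 + v.1, p.2) : plane).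
    exact: mf.
  by apply: measurable_fun_pair; first exact: measurable_funD.
have mC : measurable [set p : plane | A (p.2, p.1)].
  rewrite -[X in measurable X]setTI.
  suff mf : measurable_fun setT (fun p : plane => (p.2, p.1) : plane).
    exact: mf.
  exact: measurable_fun_pair.
have shear1 (c : R) B : measurable B ->
    leb2 [set p : plane | B (p.1, c + 1 * p.2)] = leb2 B.
  move=> mB'; rewrite (lebesgue2_shear (oner_neq0 _) (measurable_cst c) mB').
  by rewrite normr1 invr1 mul1e.
transitivity (leb2 [set p : plane | A (p.1 + v.1, p.2)]).
  rewrite -[RHS](shear1 v.2)//; congr (leb2 _).
  by apply/seteqP; split => p /=; rewrite mul1r [_ + p.2]addrC.
rewrite -lebesgue2_swap// -(lebesgue2_swap mA) -[RHS](shear1 v.1)//.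
by congr (leb2 _); apply/seteqP; split => p /=; rewrite mul1r addrC.
Qed.

Lemma measurable_sum_preimage A : measurable A ->
  measurable [set w : plane * plane | A (translate w.2 w.1)].
Proof.
move=> mA; rewrite -[X in measurable X]setTI.
suff mf : measurable_fun setT (fun w : plane * plane => translate w.2 w.1).
  exact: mf.
have f1 : measurable_fun setT (fun w : plane * plane => w.1.1).
  exact: (measurableT_comp measurable_fst).
have f2 : measurable_fun setT (fun w : plane * plane => w.1.2).
  exact: (measurableT_comp measurable_snd).
have f3 : measurable_fun setT (fun w : plane * plane => w.2.1).
  exact: (measurableT_comp measurable_fst).
have f4 : measurable_fun setT (fun w : plane * plane => w.2.2).
  exact: (measurableT_comp measurable_snd).
by apply: measurable_fun_pair; apply: measurable_funD.
Qed.

Definition box (a b c d : R) : set plane := `[a, b]%classic `*` `[c, d]%classic.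

Lemma measurable_box a b c d : measurable (box a b c d).
Proof. by apply: measurableX; exact: measurable_itv. Qed.

Lemma lebesgue2_box a b c d : a <= b -> c <= d ->
  leb2 (box a b c d) = ((b - a) * (d - c))%:E.
Proof.
move=> ab cd.
have itvE (x y : R) : x <= y -> leb `[x, y]%classic = (y - x)%:E.
  rewrite le_eqVlt => /predU1P[->|xy]; rewrite lebesgue_measure_itv/= lte_fin.
    by rewrite ltxx subrr.
  by rewrite xy -EFinB.
transitivity (leb `[a, b]%classic * leb `[c, d]%classic)%E.
  by apply: product_measure1E; exact: measurable_itv.
by rewrite !itvE.
Qed.

(* Averaging over the translations in a square trades the translation modulus
   of a measure for absolute continuity. *)
Lemma translation_bound_ac d (T : measurableType d) (mu : probability T R)
    (f : T -> plane) (e r : R) A :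
  measurable_fun setT f -> 0 <= e -> 0 < r -> measurable A ->
  (forall v, box 0 r 0 r v ->
    (mu (f @^-1` A) <= mu (f @^-1` (translate v @^-1` A)) + e%:E)%E) ->
  (mu (f @^-1` A) <= e%:E + (r ^- 2)%:E * leb2 A)%E.
Proof.
move=> mf e0 r0 mA muA.
have mfB B : measurable B -> measurable (f @^-1` B).
  by move=> mB; rewrite -[X in measurable X]setTI; exact: mf.
have mfA := mfB _ mA.
(* The section of [W] at [v] is the preimage of a translate of [A]; its section at a point of [T] is
   itself a translate of [A], of area [leb2 A]. Fubini on [W] compares the two. *)
pose W := [set w : T * plane | A (translate w.2 (f w.1))].
have mW : measurable W.
  rewrite -[X in measurable X]setTI.
  suff mg : measurable_fun setT (fun w : T * plane => (f w.1, w.2)).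
    by apply: (mg measurableT _ (measurable_sum_preimage mA)).
  by apply: measurable_fun_pair => //; exact: (measurableT_comp mf).
pose Q := box 0 r 0 r.
have mQ : measurable Q by exact: measurable_box.
have Qr : leb2 Q = (r ^+ 2)%:E by rewrite lebesgue2_box ?subr0 ?expr2// ltW.
have secE v : mu (ysection W v) = mu (f @^-1` (translate v @^-1` A)).
  by congr (mu _); apply/seteqP; split => z; rewrite /ysection/= inE.
have mu_fun : measurable_fun setT (fun v => mu (ysection W v)).
  exact: measurable_fun_ysection.
have e0' : (0 <= e%:E :> \bar R)%E by rewrite lee_fin.
have le1 : (\int[leb2]_(v in Q) (mu (f @^-1` A)) <=
    \int[leb2]_(v in Q) (mu (ysection W v) + e%:E))%E.
  apply: ge0_le_integral => //.
  - by apply: emeasurable_funD => //; exact: measurable_funTS.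
  - by move=> v Qv; rewrite secE muA.
have le2 : (\int[leb2]_(v in Q) mu (ysection W v) <= leb2 A)%E.
  apply: (@le_trans _ _ (\int[leb2]_v mu (ysection W v))%E).
    exact: ge0_subset_integral.
  have /= <- := fubini_sections mu (@sigma_finite_lebesgue2 R) mW.
  rewrite (eq_integral (cst (leb2 A))); last first.
    move=> z _ /=; rewrite -(lebesgue2_translate (f z) mA); congr (leb2 _).
    by apply/seteqP; split => v; rewrite /xsection/= inE /W/= translateC.
  by rewrite integral_cst//= probability_setT mule1.
have le3 : (mu (f @^-1` A) * (r ^+ 2)%:E <= leb2 A + e%:E * (r ^+ 2)%:E)%E.
  rewrite -Qr -!integral_cst//= (le_trans le1)// ge0_integralD//; last first.
    exact: measurable_funTS.
  by rewrite leeD2r.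
have r2 : 0 < r ^+ 2 by rewrite exprn_gt0.
rewrite -(@lee_pmul2r _ (r ^+ 2)%:E)//.
apply: (le_trans le3); rewrite addeC muleDl//.
by rewrite [in leRHS]muleAC -[((_ ^- 2)%:E * _)%E]EFinM mulVf ?mul1e// gt_eqF.
Qed.

End translations.

(** * Translation moduli *)

Section prob_contents.
Context d (T : measurableType d) (R : realType).

(** Only finite additivity is asked, because an ultralimit of measures has a priori no more; real
    values allow linear arithmetic. *)
Definition prob_content (m : set T -> R) :=
  [/\ forall A, measurable A -> 0 <= m A, m setT = 1 &
      forall A B, measurable A -> measurable B -> A `&` B = set0 ->
        m (A `|` B) = m A + m B].

Variables (m : set T -> R) (pm : prob_content m).

Lemma prob_contentD A B : measurable A -> measurable B -> A `<=` B ->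
  m B = m A + m (B `\` A).
Proof.
case: pm => _ _ mU mA mB AB; rewrite -mU//; last 2 first.
- exact: measurableD.
- by rewrite setDIK.
by rewrite setDUK.
Qed.

Lemma le_prob_content A B : measurable A -> measurable B -> A `<=` B ->
  m A <= m B.
Proof.
move=> mA mB AB; rewrite (prob_contentD mA mB AB) lerDl.
by case: pm => m0 _ _; apply: m0; exact: measurableD.
Qed.

Lemma prob_content_le1 A : measurable A -> m A <= 1.
Proof. by case: (pm) => _ <- _ mA; exact: le_prob_content. Qed.

Lemma prob_content0 : m set0 = 0.
Proof.
have := prob_contentD measurable0 measurable0 (@subset_refl _ _).
by rewrite setD0; lra.
Qed.

Lemma prob_contentC A : measurable A -> m (~` A) = 1 - m A.
Proof.
move=> mA; case: (pm) => _ m1 _.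
by have := prob_contentD mA measurableT (@subsetT _ _); rewrite setTD m1; lra.
Qed.

Lemma prob_contentU A B : measurable A -> measurable B ->
  m (A `|` B) <= m A + m B.
Proof.
move=> mA mB; rewrite (prob_contentD mA (measurableU _ _ mA mB) (@subsetUl _ _ _)).
rewrite lerD2l; apply: le_prob_content => //.
  by apply: measurableD => //; exact: measurableU.
by rewrite setDUl setDv set0U; exact: subDsetl.
Qed.


End prob_contents.

Lemma prob_content_preimage d1 d2 (T1 : measurableType d1)
    (T2 : measurableType d2) (R : realType) (m : set T1 -> R) (f : T1 -> T2) :
  measurable_fun setT f -> prob_content m ->
  prob_content (fun A => m (f @^-1` A)).
Proof.
move=> mf [m0 m1 mU].
have mfA A : measurable A -> measurable (f @^-1` A).
  by move=> mA; rewrite -[X in measurable X]setTI; exact: mf.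
split => [A mA||A B mA mB AB]; first exact/m0/mfA.
  by rewrite preimage_setT.
by rewrite preimage_setU mU//; [exact: mfA|exact: mfA|
  rewrite -preimage_setI AB preimage_set0].
Qed.

Section translation_moduli.
Variable R : realType.
Local Notation plane := (plane R).

(** A one-sided inequality suffices: applied to complements it gives the reverse one, [modulusV]. *)
Definition translation_modulus (m : set plane -> R) (v : plane) (e : R) :=
  forall A, measurable A -> m A <= m (translate v @^-1` A) + e.

Variables (m : set plane -> R) (pm : prob_content m).

Lemma modulusV v e A : translation_modulus m v e -> measurable A ->
  m (translate v @^-1` A) <= m A + e.
Proof.
move=> mv mA; have := mv _ (measurableC mA).
rewrite preimage_setC !prob_contentC//; first lra.
exact: measurable_translate_preimage.
Qed.

Lemma modulusN v e : translation_modulus m v e ->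
  translation_modulus m (- v.1, - v.2) e.
Proof.
move=> mv A mA.
have mB := measurable_translate_preimage (- v.1, - v.2) mA.
have := modulusV mv mB; congr (m _ <= _).
by apply/seteqP; split => p; rewrite /translate/= !addrK; case: p.
Qed.

End translation_moduli.

(** * The dynamics *)

Section fractional_part.
Variable R : realType.

Definition frac (t : R) : R := t - (Num.floor t)%:~R.

Lemma frac_itv t : 0 <= frac t < 1.
Proof. by rewrite /frac subr_ge0 floor_le ltrBlDl -intrD1 floorD1_gt. Qed.

Lemma floor_fracD t c : 0 <= frac t + c < 1 -> Num.floor (t + c) = Num.floor t.
Proof.
rewrite /frac => /andP[h1 h2]; apply/eqP; rewrite floor_eq intrD.
apply/andP; split; lra.
Qed.

Lemma fracD t c : 0 <= frac t + c < 1 -> frac (t + c) = frac t + c.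
Proof. by move=> /floor_fracD h; rewrite /frac h; ring. Qed.

Lemma frac_eq t (k : int) s : 0 <= s < 1 -> t = k%:~R + s -> frac t = s.
Proof.
move=> /andP[s0 s1] ->; rewrite /frac; suff -> : Num.floor (k%:~R + s) = k by ring.
by apply/eqP; rewrite floor_eq intrD; lra.
Qed.

Lemma measurable_floor : measurable_fun setT (fun t : R => (Num.floor t)%:~R : R).
Proof.
by apply: nondecreasing_measurable => // s t st; rewrite ler_int le_floor.
Qed.

Lemma measurable_frac : measurable_fun setT frac.
Proof. by apply: measurable_funB => //; exact: measurable_floor. Qed.

End fractional_part.

(** * The map in real coordinates *)

Section dynamics.
Variables (R : realType) (a b : R).
Hypothesis b0 : b != 0.
Local Notation plane := (plane R).

(* For zeta = a + i b, z = xi z - conj(zeta) (Im z / b). *)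
Definition xi (p : plane) : R := p.1 + a / b * p.2.

Definition cmul (p : plane) : plane := (a * p.1 - b * p.2, b * p.1 + a * p.2).

Definition cdiv (p : plane) : plane :=
  ((a * p.1 + b * p.2) / (a ^+ 2 + b ^+ 2),
   (a * p.2 - b * p.1) / (a ^+ 2 + b ^+ 2)).

Definition ell (p : plane) : R := xi (cmul p).

(** The imaginary part of [zeta z] divided by [b] equals [xi z], which lies in [[0, 1)] on the tile;
    hence the lattice digit is the integer [floor (ell p)]. The formula is used on the whole
    plane. *)
Definition tmap (p : plane) : plane :=
  ((cmul p).1 - (Num.floor (ell p))%:~R, (cmul p).2).

Definition abs_zeta : R := Num.sqrt (a ^+ 2 + b ^+ 2).
Local Notation beta := abs_zeta.

Definition nrm (p : plane) : R := Num.sqrt (p.1 ^+ 2 + p.2 ^+ 2).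

Lemma norm2_gt0 : 0 < a ^+ 2 + b ^+ 2.
Proof. by rewrite ltr_wpDl ?sqr_ge0// exprn_even_gt0. Qed.

Lemma beta_gt0 : 0 < beta. Proof. by rewrite sqrtr_gt0 norm2_gt0. Qed.

Lemma sqr_beta : beta ^+ 2 = a ^+ 2 + b ^+ 2.
Proof. by rewrite sqr_sqrtr// ltW// norm2_gt0. Qed.

Lemma cmulK p : cdiv (cmul p) = p.
Proof.
have := norm2_gt0; case: p => x y; rewrite /cdiv /cmul /= => h.
by congr (_, _); field; rewrite gt_eqF.
Qed.

Lemma cdivK p : cmul (cdiv p) = p.
Proof.
have := norm2_gt0; case: p => x y; rewrite /cdiv /cmul /= => h.
by congr (_, _); field; rewrite gt_eqF.
Qed.

Lemma nrm_ge0 p : 0 <= nrm p. Proof. exact: sqrtr_ge0. Qed.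

Lemma nrm_cmul p : nrm (cmul p) = beta * nrm p.
Proof.
rewrite /nrm /beta -sqrtrM ?ltW ?norm2_gt0// /cmul/=; congr Num.sqrt; ring.
Qed.

Lemma nrm_cdiv p : nrm (cdiv p) = nrm p / beta.
Proof.
by rewrite -{2}(cdivK p) nrm_cmul mulrAC mulfV ?mul1r// gt_eqF// beta_gt0.
Qed.

Lemma xi_translate v p : xi (translate v p) = xi p + xi v.
Proof. rewrite /xi /translate/=; ring. Qed.

Lemma cmul_translate v p : cmul (translate v p) = translate (cmul v) (cmul p).
Proof. by rewrite /cmul /translate/=; congr (_, _); ring. Qed.

Lemma ell_translate v p : ell (translate v p) = ell p + xi (cmul v).
Proof. by rewrite /ell cmul_translate xi_translate. Qed.

Lemma ler_abs_sqrt (x y : R) : x ^+ 2 <= y -> `|x| <= Num.sqrt y.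
Proof. by move=> xy; rewrite -sqrtr_sqr ler_wsqrtr. Qed.

(** Cauchy-Schwarz: [beta / |b|] is the length of the coefficient vector [(1, a / b)] of [xi], and
    the defect is a perfect square. *)
Lemma ler_xi_nrm p : `|xi p| <= beta / `|b| * nrm p.
Proof.
have -> : beta / `|b| * nrm p =
    Num.sqrt ((a ^+ 2 + b ^+ 2) / b ^+ 2 * (p.1 ^+ 2 + p.2 ^+ 2)).
  rewrite sqrtrM ?divr_ge0 ?addr_ge0 ?sqr_ge0//.
  by rewrite sqrtrM ?addr_ge0 ?sqr_ge0// sqrtrV ?sqr_ge0// sqrtr_sqr.
apply: ler_abs_sqrt; rewrite /xi -subr_ge0.
rewrite (_ : _ - _ = (a / b * p.1 - p.2) ^+ 2) ?sqr_ge0//.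
by field.
Qed.

Lemma ler_fst_nrm p : `|p.1| <= nrm p.
Proof. by apply: ler_abs_sqrt; rewrite lerDl sqr_ge0. Qed.

Lemma ler_snd_nrm p : `|p.2| <= nrm p.
Proof. by apply: ler_abs_sqrt; rewrite lerDr sqr_ge0. Qed.

Lemma ler_nrm p : nrm p <= `|p.1| + `|p.2|.
Proof.
rewrite /nrm -[leRHS]ger0_norm ?addr_ge0// -sqrtr_sqr ler_wsqrtr// sqrrD.
by rewrite !real_normK ?num_real// addrAC lerDl mulrn_wge0// mulr_ge0.
Qed.

Lemma frac_ell_translate v p : 0 <= frac (ell p) + xi (cmul v) < 1 ->
  frac (ell (translate v p)) = frac (ell p) + xi (cmul v).
Proof. by rewrite ell_translate => /fracD. Qed.

Lemma tmap_translate v p : 0 <= frac (ell p) + xi (cmul v) < 1 ->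
  tmap (translate v p) = translate (cmul v) (tmap p).
Proof.
move=> h; rewrite /tmap ell_translate (floor_fracD h) cmul_translate.
by rewrite /translate/=; congr (_, _); ring.
Qed.

Lemma measurable_xi : measurable_fun setT xi.
Proof. by apply: measurable_funD => //; exact: measurable_funM. Qed.

Lemma measurable_cmul : measurable_fun setT cmul.
Proof.
apply: measurable_fun_pair.
  by apply: measurable_funB; exact: measurable_funM.
by apply: measurable_funD; exact: measurable_funM.
Qed.

Lemma measurable_ell : measurable_fun setT ell.
Proof. exact: (measurableT_comp measurable_xi measurable_cmul). Qed.

Lemma measurable_tmap : measurable_fun setT tmap.
Proof.
apply: measurable_fun_pair.
  apply: measurable_funB.
    exact: (measurableT_comp measurable_fst measurable_cmul).
  exact: (measurableT_comp (@measurable_floor R) measurable_ell).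
exact: (measurableT_comp measurable_snd measurable_cmul).
Qed.

(** The strips just past the cuts, which are the lines where [ell] is an integer; [c] is their width
    measured by [ell]. *)
Definition slab (c : R) : set plane := [set p | frac (ell p) < c].

Lemma measurable_slab c : measurable (slab c).
Proof.
have mf := measurableT_comp (@measurable_frac R) measurable_ell.
have -> : slab c = (@frac R \o ell) @^-1` `]-oo, c[%classic.
  by apply/seteqP; split => p /=; rewrite in_itv.
by rewrite -[X in measurable X]setTI; exact: mf.
Qed.

Definition tile_coords : set plane :=
  [set p | 0 <= xi p < 1 /\ 0 <= p.2 / b < 1].

Lemma xi_tmap p : xi (tmap p) = frac (ell p).
Proof. rewrite /frac /ell {1}/xi /tmap /xi/=; ring. Qed.

Lemma snd_tmap p : (tmap p).2 / b = xi p.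
Proof. by rewrite /tmap /cmul /xi/=; field. Qed.

Lemma tmap_tile p : 0 <= xi p < 1 -> tile_coords (tmap p).
Proof. by rewrite /tile_coords/= xi_tmap snd_tmap frac_itv. Qed.

(** The first step brings [xi] into [[0, 1)]; the second makes a fractional part of [xi] again and
    moves the former value to the other tile coordinate. So any point of the plane enters the tile
    in two steps. *)
Lemma tmap2_tile p : tile_coords (tmap (tmap p)).
Proof. by apply: tmap_tile; rewrite xi_tmap frac_itv. Qed.

Lemma tmapE p (k : int) : 0 <= xi p < 1 -> 
  forall q, cmul q = (p.1 + k%:~R, p.2) -> tmap q = p.
Proof.
move=> xp q qE; have -> : tmap q = ((cmul q).1 - k%:~R, (cmul q).2).
  rewrite /tmap; congr (_ - _%:~R, _); apply/eqP; rewrite floor_eq.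
  rewrite /ell qE intrD; move: xp; rewrite /xi/=; lra.
by rewrite qE/= addrK; case: (p).
Qed.

End dynamics.

(** * A Lasota-Yorke inequality for translation moduli *)

Section lasota_yorke.
Variables (R : realType) (a b : R).
Hypothesis b0 : b != 0.
Local Notation plane := (plane R).
Local Notation xi := (xi a b).
Local Notation cmul := (cmul a b).
Local Notation cdiv := (cdiv a b).
Local Notation ell := (ell a b).
Local Notation tmap := (tmap a b).
Local Notation slab := (slab a b).
Local Notation beta := (abs_zeta a b).

Section one_content.
Variables (m : set plane -> R) (pm : prob_content m).

Lemma slab0 c : c <= 0 -> slab c = set0.
Proof.
move=> c0; apply/seteqP; split => p //; rewrite /slab/= => h.
by have := frac_itv (ell p); lra.
Qed.

(* The slabs are translates of each other, so each of them has at least the mass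
   of the first one up to [e]. *)
Lemma slab_bound w e : translation_modulus m w e -> 0 <= xi (cmul w) <= 1 ->
  m (slab (xi (cmul w))) <= e + 2 * xi (cmul w).
Proof.
move=> mw; set c := xi _ => /andP[c0 c1].
have e0 : 0 <= e.
  by have := mw _ measurableT; rewrite preimage_setT; lra.
move: c0; rewrite le_eqVlt => /predU1P[<-|c0].
  by rewrite slab0// prob_content0//; lra.
(* Translation by [w] carries [slab (N * c)] into what remains of [slab (N.+1 * c)] after removing
   [slab c], so each further copy of [slab c] costs [e]. The condition [N * c <= 1] prevents
   wrapping around. *)
have key N : N%:R * c <= 1 ->
    N%:R * m (slab c) <= m (slab (N%:R * c)) + N%:R * e.
  elim: N => [|N ih Nc].
    by rewrite !mul0r addr0 slab0// prob_content0.
  have NSE : N.+1%:R = N%:R + 1 :> R by rewrite -natr1.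
  have mN := measurable_slab a b (N%:R * c).
  have mNS := measurable_slab a b (N.+1%:R * c).
  have mc := measurable_slab a b c.
  have c_sub : slab c `<=` slab (N.+1%:R * c).
    move=> p; rewrite /slab/= NSE => h.
    have : 0 <= N%:R * c by rewrite mulr_ge0// ltW.
    lra.
  have sub : slab (N%:R * c) `<=` translate w @^-1` (slab (N.+1%:R * c) `\` slab c).
    move=> p; rewrite /slab/= => h; have := frac_itv (ell p) => h'.
    have hc : 0 <= frac (ell p) + xi (cmul w) < 1.
      by rewrite -/c; move: Nc c0 h'; rewrite NSE; lra.
    rewrite frac_ell_translate// -/c NSE; split; first lra.
    by apply/negP; rewrite -leNgt; lra.
  have mD := measurableD mNS mc.
  have := le_prob_content pm mN (measurable_translate_preimage w mD) sub.
  have := modulusV pm mw mD.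
  have := prob_contentD pm mc mNS c_sub.
  have : N%:R * c <= 1 by move: Nc; rewrite NSE; lra.
  move=> /ih; rewrite NSE; lra.
(* With [N] the integer part of [1 / c], [key] bounds [N] copies of the slab mass by [1 + N * e],
   while [1 < (N + 1) * c <= 2 * N * c]; dividing by [N] gives the claim. *)
have /andP[N1 N2] : (Num.truncn c^-1)%:R <= c^-1 < (Num.truncn c^-1).+1%:R.
  by apply: truncn_itv; rewrite invr_ge0 ltW.
set N := Num.truncn _ in N1 N2.
have Nc : N%:R * c <= 1 by rewrite -ler_pdivlMr// mul1r.
have NSc : 1 < (N%:R + 1) * c by rewrite -ltr_pdivrMr// mul1r natr1.
have N0 : 0 < N%:R :> R.
  rewrite ltr0n lt0n; apply/negP => /eqP N0; move: NSc; rewrite N0; lra.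
have N1' : 1 <= N%:R :> R by move: N0; rewrite ltr0n ler1n.
have := key N Nc; have := prob_content_le1 pm (measurable_slab a b (N%:R * c)).
move=> h1 h2; rewrite -(ler_pM2l N0).
have : N%:R * c >= c by rewrite ler_peMl// ltW.
lra.
Qed.

(** Translation by [w] pushes the strips just before the cuts across them into [slab c], which costs
    one more [e] than [slab_bound]. *)
Lemma slab_boundC w e : translation_modulus m w e -> 0 <= xi (cmul w) <= 1 ->
  m (~` slab (1 - xi (cmul w))) <= 2 * e + 2 * xi (cmul w).
Proof.
move=> mw c01; have := slab_bound mw c01; move: c01.
set c := xi _ => c01 h.
have mc := measurable_slab a b c.
have mc' := measurable_slab a b (1 - c).
have := modulusV pm mw mc.
suff : m (~` slab (1 - c)) <= m (translate w @^-1` slab c) by lra.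
apply: le_prob_content => //; first exact: measurableC.
  exact: measurable_translate_preimage.
move=> p; rewrite /slab/= => /negP; rewrite -leNgt => h'.
have := frac_itv (ell p) => h''.
rewrite ell_translate -/c (@frac_eq _ _ (Num.floor (ell p) + 1) (frac (ell p) + c - 1)).
- lra.
- lra.
- by rewrite /frac intrD; ring.
Qed.

(** If [p + w] avoids [slab c], no cut separates [p] from [p + w], and the map turns the shift by
    [w] into the shift by [cmul w]. This costs [e]; discarding the slab costs [e + 2 * c]. Hence the
    doubling of [e]. *)
Lemma modulus_tmap_ge0 w e : translation_modulus m w e -> 0 <= xi (cmul w) ->
  translation_modulus (fun A => m (tmap @^-1` A)) (cmul w) (2 * e + 2 * xi (cmul w)).
Proof.
move=> mw c0 A mA; have mT B : measurable B -> measurable (tmap @^-1` B).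
  by move=> mB; rewrite -[X in measurable X]setTI; exact: measurable_tmap.
have mTA := mT _ mA.
have mtA := mT _ (measurable_translate_preimage (cmul w) mA).
(* For [xi (cmul w) > 1] the error term already exceeds the total mass. *)
have [c1|c1] := leP (xi (cmul w)) 1; last first.
  have := prob_content_le1 pm mTA; case: (pm) => m0 _ _; have := m0 _ mtA.
  have : 0 <= e.
    by have := mw _ measurableT; rewrite preimage_setT; lra.
  lra.
set c := xi _ in c0 c1 *; have mc := measurable_slab a b c.
have mB : measurable (tmap @^-1` A `\` slab c) by exact: measurableD.
have h1 : m (tmap @^-1` A) <= m (tmap @^-1` A `\` slab c) + m (slab c).
  rewrite (le_trans _ (prob_contentU pm mB mc))// le_prob_content//.
    exact: measurableU.
  by move=> x Ax; have [?|?] := pselect (slab c x); [right|left].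
have h2 := mw _ mB.
have h3 : m (translate w @^-1` (tmap @^-1` A `\` slab c)) <=
    m (tmap @^-1` (translate (cmul w) @^-1` A)).
  apply: le_prob_content => //; first exact: measurable_translate_preimage.
  move=> p [/= TA]; rewrite /slab/= => /negP; rewrite -leNgt => h.
  suff fp : 0 <= frac (ell p) + c < 1 by rewrite -tmap_translate.
  move: h; rewrite ell_translate -/c.
  have := frac_itv (ell p); have := frac_itv (ell p + c) => h' h'' h.
  case: (ltP (frac (ell p) + c) 1) => [|h1']; first lra.
  move: h; rewrite (@frac_eq _ _ (Num.floor (ell p) + 1) (frac (ell p) + c - 1)).
  - lra.
  - lra.
  - by rewrite /frac intrD; ring.
have h4 : m (slab c) <= e + 2 * c by apply: slab_bound => //; rewrite -/c; lra.
lra.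
Qed.

Lemma modulus_tmap w e : translation_modulus m w e ->
  translation_modulus (fun A => m (tmap @^-1` A)) (cmul w)
    (2 * e + 2 * `|xi (cmul w)|).
Proof.
move=> mw; have [c0|c0] := leP 0 (xi (cmul w)).
  by rewrite ger0_norm//; exact: modulus_tmap_ge0.
have mT := prob_content_preimage (measurable_tmap a b) pm.
have cN : cmul (- w.1, - w.2) = (- (cmul w).1, - (cmul w).2).
  by rewrite /cmul/=; congr (_, _); ring.
have xN : xi (cmul (- w.1, - w.2)) = - xi (cmul w).
  by rewrite cN /xi/=; ring.
have := modulus_tmap_ge0 (modulusN pm mw); rewrite xN oppr_ge0 ltW// => /(_ isT).
move=> /(modulusN mT); rewrite ltr0_norm//; congr translation_modulus.
by rewrite cN/= !opprK.
Qed.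

End one_content.

(** For a measure with a density, such a linear bound amounts to bounded variation of the density;
    [K] takes the place of a BV norm without any density being mentioned. *)
Definition regular (K : R) (m : set plane -> R) :=
  prob_content m /\ forall v, translation_modulus m v (K * nrm v).

(** Pulling [v] back by [cdiv] divides its length by [beta], [modulus_tmap] doubles the modulus, and
    wrapping adds at most [2 * (beta / |b|) * nrm v]. The hypothesis says that [K] absorbs
    [2 * K / beta] plus this constant. *)
Lemma regular_tmap K m : 2 * (beta / `|b|) <= K * (1 - 2 / beta) ->
  regular K m -> regular K (fun A => m (tmap @^-1` A)).
Proof.
move=> hK [pm mK]; split.
  by apply: prob_content_preimage => //; exact: measurable_tmap.
move=> v A mA; have := modulus_tmap pm (mK (cdiv v)) mA.
rewrite cdivK// nrm_cdiv// => h; apply: (le_trans h); rewrite lerD2l.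
have := ler_xi_nrm a b0 v; have := nrm_ge0 v.
set n := nrm v => n0 hx.
have : 2 * (beta / `|b|) * n <= K * (1 - 2 / beta) * n by rewrite ler_wpM2r.
lra.
Qed.

End lasota_yorke.

(** * Existence of an ACIM *)

Section probability_contents.
Context d (T : measurableType d) (R : realType).

Lemma probability_content (P : probability T R) :
  prob_content (fun A => fine (P A)).
Proof.
split => [A mA||A B mA mB AB]; first exact: fine_ge0.
  by rewrite probability_setT.
by rewrite measureU//= fineD// fin_num_measure.
Qed.

Lemma probability_fineK (P : probability T R) A : measurable A ->
  (fine (P A))%:E = P A.
Proof. by move=> mA; rewrite fineK// fin_num_measure. Qed.

End probability_contents.

(** * The uniform measure on a square *)

Section uniform_box.
Variables (R : realType) (r : R) (r0 : 0 < r).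
Local Notation plane := (plane R).
Local Notation leb2 := (@lebesgue2 R).
Local Notation Q := (box (- r) r (- r) r).

Lemma inv_area_ge0 : 0 <= (2 * r) ^- 2.
Proof. by rewrite invr_ge0 exprn_ge0// mulr_ge0// ltW. Qed.

Definition uniform_box : set plane -> \bar R :=
  mscale (NngNum inv_area_ge0) (mrestr leb2 (measurable_box (- r) r (- r) r)).

HB.instance Definition _ := Measure.on uniform_box.

Lemma uniform_boxE A : uniform_box A = (((2 * r) ^- 2)%:E * leb2 (A `&` Q))%E.
Proof. by []. Qed.

Lemma uniform_boxT : uniform_box setT = 1%E.
Proof.
have rN : - r <= r by move: (r0); lra.
rewrite uniform_boxE setTI lebesgue2_box//.
rewrite -EFinM; congr EFin; field; exact: lt0r_neq0.
Qed.

HB.instance Definition _ := Measure_isProbability.Build _ _ _ uniform_box uniform_boxT.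

(** The shifted square leaves the square only through four thin rectangles along the sides, two of
    area [2 r |v.1|] and two of area [2 r |v.2|]. *)
Lemma lebesgue2_box_diff (v : plane) :
  (leb2 (translate v @^-1` Q `\` Q) <= (4 * r * (`|v.1| + `|v.2|))%:E)%E.
Proof.
have rN : - r <= r by move: (r0); lra.
pose B1 := box (- r - `|v.1|) (- r) (- r - v.2) (r - v.2).
pose B2 := box r (r + `|v.1|) (- r - v.2) (r - v.2).
pose B3 := box (- r - v.1) (r - v.1) (- r - `|v.2|) (- r).
pose B4 := box (- r - v.1) (r - v.1) r (r + `|v.2|).
have sub : translate v @^-1` Q `\` Q `<=` (B1 `|` B2) `|` (B3 `|` B4).
  move=> [x y]; rewrite /box /translate/= !in_itv/= => -[[/andP[h1 h2] /andP[h3 h4]] nQ].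
  have hv1 := ler_norm v.1; have hv2 := ler_norm v.2.
  have hw1 := ler_norm (- v.1); have hw2 := ler_norm (- v.2).
  rewrite !normrN in hw1 hw2.
  rewrite /B1 /B2 /B3 /B4 /box /= !in_itv/=.
  have [x1|x1] := ltP x (- r).
    by left; left; split; lra.
  have [x2|x2] := ltP r x.
    by left; right; split; lra.
  have [y1|y1] := ltP y (- r).
    by right; left; split; lra.
  have [y2|y2] := ltP r y.
    by right; right; split; lra.
  by exfalso; apply: nQ; split; lra.
have mB (a b c d : R) : measurable (box a b c d) by exact: measurable_box.
have mQ : measurable Q by exact: mB.
have mQ' := measurable_translate_preimage v mQ.
have m12 : measurable (B1 `|` B2) by apply: measurableU; exact: mB.
have m34 : measurable (B3 `|` B4) by apply: measurableU; exact: mB.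
apply: (@le_trans _ _ (leb2 ((B1 `|` B2) `|` (B3 `|` B4)))).
  by apply: le_measure => //; rewrite ?inE; [exact: measurableD|exact: measurableU].
have n1 := normr_ge0 v.1; have n2 := normr_ge0 v.2.
have rp := r0.
apply: (@le_trans _ _ ((leb2 B1 + leb2 B2) + (leb2 B3 + leb2 B4))%E).
  apply: (le_trans (measureU2 _ m12 m34)).
  by apply: leeD; apply: measureU2; exact: mB.
have -> : leb2 B1 = (`|v.1| * (2 * r))%:E.
  by rewrite lebesgue2_box; [congr EFin; ring|lra|lra].
have -> : leb2 B2 = (`|v.1| * (2 * r))%:E.
  by rewrite lebesgue2_box; [congr EFin; ring|lra|lra].
have -> : leb2 B3 = (`|v.2| * (2 * r))%:E.
  by rewrite lebesgue2_box; [congr EFin; ring|lra|lra].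
have -> : leb2 B4 = (`|v.2| * (2 * r))%:E.
  by rewrite lebesgue2_box; [congr EFin; ring|lra|lra].
by rewrite -!EFinD lee_fin; lra.
Qed.

(** By translation invariance of area, only the boundary layer measured in [lebesgue2_box_diff] can
    be lost. *)
Lemma uniform_box_modulus v :
  translation_modulus (fun A => fine (uniform_box A)) v (2 / r * nrm v).
Proof.
move=> A mA; have mB := measurable_translate_preimage v mA.
have mQ : measurable Q by exact: measurable_box.
have mQ' := measurable_translate_preimage v mQ.
have fE B : measurable B ->
    (fine (uniform_box B))%:E = (((2 * r) ^- 2)%:E * leb2 (B `&` Q))%E.
  by move=> mB'; rewrite (probability_fineK uniform_box).
rewrite -lee_fin EFinD !fE//.
apply: (@le_trans _ _ (((2 * r) ^- 2)%:E *
    (leb2 (translate v @^-1` A `&` Q) + leb2 (translate v @^-1` Q `\` Q)))%E).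
  apply: lee_pmul => //; first by rewrite lee_fin inv_area_ge0.
  rewrite -(lebesgue2_translate v (measurableI _ _ mA mQ)) preimage_setI.
  have m1 : measurable (translate v @^-1` A `&` Q) by exact: measurableI.
  have m2 : measurable (translate v @^-1` Q `\` Q) by exact: measurableD.
  apply: le_trans (measureU2 _ m1 m2); apply: le_measure; rewrite ?inE.
  - exact: measurableI.
  - exact: measurableU.
  - move=> p [Ap Qp]; have [Q'p|Q'p] := pselect (Q p); first by left.
    by right.
rewrite ge0_muleDr// leeD2l//.
apply: (le_trans (lee_pmul _ _ (lexx _) (lebesgue2_box_diff v))) => //.
  by rewrite lee_fin inv_area_ge0.
rewrite -EFinM lee_fin.
have -> : (2 * r) ^- 2 * (4 * r * (`|v.1| + `|v.2|)) = (`|v.1| + `|v.2|) / r.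
  by field; exact: lt0r_neq0.
rewrite mulrAC ler_pM2r ?invr_gt0//.
by have := ler_fst_nrm v; have := ler_snd_nrm v; lra.
Qed.

End uniform_box.

(** * From contents to measures *)

Section content_probability.
Context d (T : measurableType d) (R : realType).
Variables (m : set T -> R) (pm : prob_content m).

Lemma prob_content_bigcup (F : nat -> set T) n : (forall i, measurable (F i)) ->
  trivIset setT F -> m (\big[setU/set0]_(i < n) F i) = \sum_(i < n) m (F i).
Proof.
move=> mF tF; elim: n => [|n ih]; first by rewrite !big_ord0 prob_content0.
rewrite !big_ord_recr/= -ih; case: (pm) => _ _ -> //.
  exact: bigsetU_measurable.
apply/seteqP; split => // x []; rewrite -bigcup_mkord => -[i /= i_n Fi] Fn.
by move: i_n; rewrite (tF i n) ?ltnn//; exists x.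
Qed.

Hypothesis cont_m : forall F : nat -> set T, (forall i, measurable (F i)) ->
  nonincreasing_seq F -> \bigcap_n F n = set0 -> m (F n) @[n --> \oo] --> (0 : R).

(** The value 0 off the measurable sets secures nonnegativity on all sets, since [m] is controlled
    only on measurable ones. *)
Definition measure_of_content (A : set T) : \bar R :=
  if A \in measurable then (m A)%:E else 0%E.

Let mcE A : measurable A -> measure_of_content A = (m A)%:E.
Proof. by move=> mA; rewrite /measure_of_content mem_set. Qed.

Let mc0 : measure_of_content set0 = 0%E.
Proof. by rewrite mcE// prob_content0. Qed.

Let mc_ge0 A : (0 <= measure_of_content A)%E.
Proof.
rewrite /measure_of_content; case: ifPn => // /[!inE] mA.
by rewrite lee_fin; case: pm => m0 _ _; exact: m0.
Qed.

Let mc_sigma_additive : semi_sigma_additive measure_of_content.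
Proof.
move=> F mF tF mU.
(* These tails decrease to the empty set, so continuity there makes the error of the partial sums
   vanish. *)
pose G n := \bigcup_n F n `\` \big[setU/set0]_(i < n) F i.
have mbig n : measurable (\big[setU/set0]_(i < n) F i).
  exact: bigsetU_measurable.
have mG n : measurable (G n) by exact: measurableD.
have big_sub n : \big[setU/set0]_(i < n) F i `<=` \bigcup_n F n.
  by rewrite -bigcup_mkord => x [i _ Fi]; exists i.
have G0 : m (G n) @[n --> \oo] --> (0 : R).
  apply: cont_m => //.
  - move=> i j ij; apply/subsetPset; apply: setDS.
    by rewrite -!bigcup_mkord => x [k /= ki Fk]; exists k => //=; exact: leq_trans ij.
  - apply/seteqP; split => // x Gx; have [[i _ Fi] _] := Gx 0%N I.
    have [_] := Gx i.+1 I; apply; rewrite -bigcup_mkord; exists i => //=.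
rewrite (_ : (fun n => _) = (fun n => (m (\bigcup_n F n) - m (G n))%:E)).
  rewrite mcE//; apply: cvg_EFin; first exact: nearW.
  rewrite -[X in _ --> X]subr0; apply: cvgB => //; exact: cvg_cst.
apply/funext => n; rewrite big_mkord (eq_bigr (fun i : 'I_n => (m (F i))%:E)).
  rewrite sumEFin -prob_content_bigcup//; congr EFin.
  by rewrite (prob_contentD pm (mbig n) mU (big_sub n)) addrK.
by move=> i _; rewrite mcE.
Qed.

HB.instance Definition _ := isMeasure.Build _ _ _ measure_of_content
  mc0 mc_ge0 mc_sigma_additive.

Let mcT : measure_of_content setT = 1%E.
Proof. by rewrite mcE//; case: pm => _ -> _. Qed.

HB.instance Definition _ :=
  Measure_isProbability.Build _ _ _ measure_of_content mcT.

Lemma content_probability : exists P : probability T R,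
  forall A, measurable A -> P A = (m A)%:E.
Proof. by exists measure_of_content. Qed.

End content_probability.

(** * Uniform regularity of the push-forwards *)

Section iterates.
Variables (R : realType) (a b : R).
Hypothesis b0 : b != 0.
Local Notation plane := (plane R).
Local Notation leb2 := (@lebesgue2 R).
Local Notation tmap := (tmap a b).
Local Notation beta := (abs_zeta a b).
Variables (r : R) (r0 : 0 < r).
Hypothesis beta2 : 2 < beta.

Definition iter_content n (A : set plane) : R :=
  fine (uniform_box r0 (iter n tmap @^-1` A)).

(** The first term is the modulus of the initial uniform measure; the second is the fixed point of
    [K |-> 2 * K / beta + 2 * (beta / |b|)], the recursion of [regular_tmap]. *)
Definition regular_const : R :=
  Num.max (2 / r) (2 * (beta / `|b|) / (1 - 2 / beta)).

Lemma regular_const_ge0 : 0 <= regular_const.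
Proof. by rewrite le_max divr_ge0// ltW. Qed.

Lemma regular_const_ge : 2 * (beta / `|b|) <= regular_const * (1 - 2 / beta).
Proof.
rewrite -ler_pdivrMr ?le_max ?lexx ?orbT//.
by rewrite subr_gt0 ltr_pdivrMr ?mul1r// (lt_trans _ beta2).
Qed.

Lemma measurable_iter_tmap n : measurable_fun setT (iter n tmap).
Proof.
elim: n => [|n ih]; first exact: measurable_id.
exact: (measurableT_comp (measurable_tmap a b) ih).
Qed.

Lemma iter_content_regular n : regular regular_const (iter_content n).
Proof.
elim: n => [|n ih].
  split; first exact: (probability_content (uniform_box r0)).
  move=> v A mA; apply: (le_trans (@uniform_box_modulus _ _ r0 v A mA)).
  by rewrite lerD2l ler_wpM2r ?nrm_ge0// le_max lexx.
exact: (regular_tmap b0 regular_const_ge ih).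
Qed.

(** Translations in a square of side [e] have length at most [2 * e]; averaging over them turns
    regularity into absolute continuity with constants independent of [n]. *)
Lemma iter_content_ac n A e : 0 < e -> measurable A ->
  ((iter_content n A)%:E <=
    (2 * regular_const * e)%:E + (e ^- 2)%:E * leb2 A)%E.
Proof.
move=> e0 mA; have [pm mK] := iter_content_regular n.
have mi := measurable_iter_tmap n.
have mf B : measurable B -> measurable (iter n tmap @^-1` B).
  by move=> mB; rewrite -[X in measurable X]setTI; exact: mi.
have fE B : measurable B ->
    uniform_box r0 (iter n tmap @^-1` B) = (iter_content n B)%:E.
  by move=> mB; rewrite /iter_content (probability_fineK (uniform_box r0))//; exact: mf.
rewrite -fE//.
apply: (@translation_bound_ac _ _ _ (uniform_box r0)) => //.
  by rewrite !mulr_ge0 ?regular_const_ge0// ltW.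
move=> v; rewrite /box/= !in_itv/= => -[/andP[v1 v1'] /andP[v2 v2']].
have mvA := measurable_translate_preimage v mA.
rewrite !fE// -EFinD lee_fin (le_trans (mK v A mA))// lerD2l.
rewrite -mulrA mulrCA ler_wpM2l ?regular_const_ge0//.
by rewrite (le_trans (ler_nrm v))// !ger0_norm//; lra.
Qed.

End iterates.

(** Compactness provides a cluster point, and the ultrafilter dichotomy between a set and its
    complement makes it a limit. *)
Lemma ultra_cvg_segment (T : Type) (R : realType) (U : set_system T)
    (u : T -> R) (x y : R) : UltraFilter U ->
  (forall n, x <= u n <= y) -> exists l : R, u n @[n --> U] --> l.
Proof.
move=> UU uxy; have PF : ProperFilter (u n @[n --> U]).
  by apply: fmap_proper_filter; exact: ultra_proper.
have Fxy : (u n @[n --> U]) `[x, y]%classic.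
  by apply: (@filterE _ U) => n /=; rewrite in_itv/= uxy.
have [l [_ cl]] := @segment_compact R x y _ PF Fxy; exists l => V Vl.
have [//|UV] := in_ultra_setVsetC (u @^-1` V) UU.
have UV' : (u n @[n --> U]) (~` V) by [].
by have [z [nVz Vz]] := cl _ _ UV' Vl.
Qed.

Section existence.
Variables (R : realType) (a b : R).
Hypothesis b0 : b != 0.
Local Notation plane := (plane R).
Local Notation leb2 := (@lebesgue2 R).
Local Notation tmap := (tmap a b).
Local Notation beta := (abs_zeta a b).
Hypothesis beta2 : 2 < beta.
Local Notation m_ := (iter_content a b (@ltr01 R)).

Definition cesaro (n : nat) (A : set plane) : R :=
  (\sum_(i < n.+1) m_ i A) / n.+1%:R.

Let mT A : measurable A -> measurable (tmap @^-1` A).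
Proof. by move=> mA; rewrite -[X in measurable X]setTI; exact: measurable_tmap. Qed.

Let mprob n : prob_content (m_ n).
Proof. exact: (iter_content_regular b0 ltr01 beta2 n).1. Qed.

Lemma sum_le_avg n (f : nat -> R) c : (forall i, f i <= c) ->
  (\sum_(i < n.+1) f i) / n.+1%:R <= c.
Proof.
move=> fc; rewrite ler_pdivrMr ?ltr0n// mulr_natr -[X in _ *+ X]card_ord -sumr_const.
exact: ler_sum.
Qed.

Lemma cesaro_itv n A : measurable A -> 0 <= cesaro n A <= 1.
Proof.
move=> mA; apply/andP; split.
  by rewrite divr_ge0// sumr_ge0// => i _; case: (mprob i) => m0 _ _; exact: m0.
by apply: (@sum_le_avg _ (m_^~ A)) => i; exact: prob_content_le1.
Qed.

Lemma cesaroU n A B : measurable A -> measurable B -> A `&` B = set0 ->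
  cesaro n (A `|` B) = cesaro n A + cesaro n B.
Proof.
move=> mA mB AB; rewrite /cesaro -mulrDl -big_split/=; congr (_ / _).
by apply: eq_bigr => i _; case: (mprob i) => _ _; exact.
Qed.


Lemma cesaro_tmap n A : measurable A ->
  `|cesaro n (tmap @^-1` A) - cesaro n A| <= n.+1%:R^-1.
Proof.
move=> mA; rewrite /cesaro -mulrBl.
have -> : \sum_(i < n.+1) m_ i (tmap @^-1` A) - \sum_(i < n.+1) m_ i A =
    m_ n.+1 A - m_ 0%N A.
  rewrite -sumrB -(big_mkord xpredT (fun i => m_ i (tmap @^-1` A) - m_ i A)).
  exact: (telescope_sumr (fun i => m_ i A)).
rewrite normrM [X in _ * X]ger0_norm ?invr_ge0// -[leRHS]mul1r ler_wpM2r//.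
have h n' : 0 <= m_ n' A <= 1.
  by rewrite prob_content_le1// andbT; case: (mprob n') => m0 _ _; exact: m0.
by have := h n.+1; have := h 0%N; rewrite ler_norml; lra.
Qed.

Lemma measurable_tile_coords : measurable (tile_coords a b).
Proof.
have -> : tile_coords a b = (xi a b @^-1` `[0, 1[%classic) `&`
    ((fun p : plane => p.2 / b) @^-1` `[0, 1[%classic).
  by apply/seteqP; split => p; rewrite /tile_coords/= !in_itv/=.
have m1 := measurable_xi a b.
have m2 : measurable_fun setT (fun p : plane => p.2 / b) by exact: measurable_funM.
by apply: measurableI; rewrite -[X in measurable X]setTI; [exact: m1|exact: m2].
Qed.

Lemma tile_coords_box : tile_coords a b `<=`
  box (- (1 + `|a|)) (1 + `|a|) (- `|b|) `|b|.
Proof.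
move=> p []; set t := p.2 / b => /andP[x0 x1] /andP[t0 t1].
have pE : p.2 = b * t by rewrite /t mulrC divfK.
have xE : p.1 = xi a b p - a * t by rewrite /xi pE; field.
have b_t : `|b * t| <= `|b| by rewrite normrM ler_piMr// ger0_norm// ltW.
have a_t : `|a * t| <= `|a| by rewrite normrM ler_piMr// ger0_norm// ltW.
rewrite /box/= !in_itv/= xE pE; split; last by rewrite -ler_norml.
by move: a_t; rewrite ler_norml; lra.
Qed.

Lemma lebesgue2_tile_coords_lty : (leb2 (tile_coords a b) < +oo)%E.
Proof.
have mB := measurable_box (- (1 + `|a|)) (1 + `|a|) (- `|b|) `|b|.
have mX := measurable_tile_coords.
have : (leb2 (tile_coords a b) <=
    leb2 (box (- (1 + `|a|)) (1 + `|a|) (- `|b|) `|b|))%E.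
  by apply: le_measure; rewrite ?inE//; exact: tile_coords_box.
have na := normr_ge0 a; have nb := normr_ge0 b.
move=> /le_lt_trans; apply; rewrite lebesgue2_box ?ltry//; lra.
Qed.

(* An ultralimit of the Cesaro means is only finitely additive a priori; the
   uniform bound [iter_content_ac] makes it a measure. *)
Theorem exists_acim : exists P : probability plane R,
  [/\ P (tile_coords a b) = 1%E,
      forall A, measurable A -> P (tmap @^-1` A) = P A &
      forall A, measurable A -> leb2 A = 0%E -> P A = 0%E].
Proof.
have [U [UU sU]] := @ultraFilterLemma nat \oo eventually_filter.
have PU : ProperFilter U by exact: ultra_proper.
have [K K0 K_ac] : exists2 K : R, 0 <= K & forall n A e, 0 < e -> measurable A ->
    ((m_ n A)%:E <= (2 * K * e)%:E + (e ^- 2)%:E * leb2 A)%E.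
  exists (regular_const a b 1); first exact: regular_const_ge0.
  by move=> n A e; exact: iter_content_ac.
have lim_ex A : measurable A -> exists l : R, cesaro n A @[n --> U] --> l.
  by move=> mA; apply: (@ultra_cvg_segment _ _ _ _ 0 1) => // n; exact: cesaro_itv.
pose m A := lim (cesaro n A @[n --> U]).
have mP A : measurable A -> cesaro n A @[n --> U] --> m A.
  by move=> /lim_ex[l ul]; rewrite /m; apply/cvg_ex; exists l.
have m_uniq A l : cesaro n A @[n --> U] --> l -> m A = l.
  by move=> h; apply/cvg_lim.
have m_le A c : measurable A -> (forall n, cesaro n A <= c) -> m A <= c.
  by move=> mA h; apply: limr_le; [apply/cvg_ex; exact: lim_ex|exact: nearW].
have m_ge A c : measurable A -> (forall n, c <= cesaro n A) -> c <= m A.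
  by move=> mA h; apply: limr_ge; [apply/cvg_ex; exact: lim_ex|exact: nearW].
have pm : prob_content m.
  split.
  - by move=> A mA; apply: m_ge => // n; have /andP[] := cesaro_itv n mA.
  - apply: m_uniq; rewrite (_ : (fun n => _) = cst 1); first exact: cvg_cst.
    apply/funext => n; rewrite /cesaro (eq_bigr (fun=> 1)).
      by rewrite sumr_const card_ord divff// pnatr_eq0.
    by move=> i _; case: (mprob i).
  - move=> A B mA mB AB; apply: m_uniq.
    rewrite (_ : (fun n => _) = (fun n => cesaro n A + cesaro n B)).
      by apply: cvgD; exact: mP.
    by apply/funext => n; exact: cesaroU.
(* The difference of Cesaro means is at most [1 / (n + 1)], so it tends to 0 in the usual sense,
   hence along the finer filter [U]. *)
have m_inv A : measurable A -> m (tmap @^-1` A) = m A.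
  move=> mA; apply/eqP; rewrite -subr_eq0; apply/eqP.
  have h1 : cesaro n (tmap @^-1` A) - cesaro n A @[n --> U] -->
      m (tmap @^-1` A) - m A by apply: cvgB; apply: mP => //; exact: mT.
  have h2 : cesaro n (tmap @^-1` A) - cesaro n A @[n --> U] --> (0 : R).
    apply: (@cvg_trans _ _ _ _ (cvg_app _ sU)).
    apply: (@squeeze_cvgr _ _ _ _ (fun n => - harmonic n) harmonic).
    - by apply: nearW => n; rewrite -ler_norml; exact: cesaro_tmap.
    - by rewrite -oppr0; apply: cvgN; exact: cvg_harmonic.
    - exact: cvg_harmonic.
  exact: (cvg_unique _ h1 h2).
have m_ac A e : 0 < e -> measurable A ->
    ((m A)%:E <= (2 * K * e)%:E + (e ^- 2)%:E * leb2 A)%E.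
  move=> e0 mA; have [->|fin] := eqVneq (leb2 A) +oo%E.
    by rewrite gt0_muley ?lte_fin ?invr_gt0 ?exprn_gt0// addey// leey.
  have {}fin : leb2 A \is a fin_num by rewrite ge0_fin_numE// ltey.
  rewrite -(fineK fin) -EFinM -EFinD lee_fin; apply: m_le => // n.
  apply: (@sum_le_avg _ (m_^~ A)) => i.
  rewrite -lee_fin EFinD (EFinM (e ^- 2)) (fineK fin).
  exact: K_ac.
clearbody m => {lim_ex mP m_uniq m_le m_ge}.
(* By [tmap2_tile], the second preimage of the tile is the whole plane. *)
have m_tile : m (tile_coords a b) = 1.
  rewrite -m_inv; last exact: measurable_tile_coords.
  rewrite -m_inv; last by apply: mT; exact: measurable_tile_coords.
  case: (pm) => _ <- _; congr m; apply/seteqP; split => // p _.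
  exact: tmap2_tile.
have mX := measurable_tile_coords.
have m_tileI A : measurable A -> m A = m (A `&` tile_coords a b).
  move=> mA; apply/eqP; rewrite eq_le; apply/andP; split; last first.
    by apply: le_prob_content => //; exact: measurableI.
  have mI := measurableI _ _ mA mX; have mD := measurableC mX.
  apply: (@le_trans _ _ (m (A `&` tile_coords a b) + m (~` tile_coords a b))).
    rewrite (le_trans _ (prob_contentU pm mI mD))// le_prob_content//.
      exact: measurableU.
    by move=> p Ap; have [?|?] := pselect (tile_coords a b p); [left|right].
  by rewrite prob_contentC// m_tile subrr addr0.
have X_fin := lebesgue2_tile_coords_lty.
(* Cutting down to the tile, of finite area and full mass, makes the areas tend to 0; [m_ac] then
   transfers this to [m]. *)
have cont F : (forall i, measurable (F i)) -> nonincreasing_seq F ->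
    \bigcap_n F n = set0 -> m (F n) @[n --> \oo] --> (0 : R).
  move=> mF niF F0; pose G n := F n `&` tile_coords a b.
  have mG n : measurable (G n) by exact: measurableI.
  have G0 : leb2 (G n) @[n --> \oo] --> 0%:E.
    have <- : leb2 (\bigcap_n G n) = 0%:E.
      rewrite (_ : \bigcap_n G n = set0) ?measure0//.
      by apply/seteqP; split => // p Gp; rewrite -F0 => n _; case: (Gp n).
    apply: nonincreasing_cvg_mu => //.
    - by rewrite (le_lt_trans _ X_fin)// measureIr.
    - exact: bigcapT_measurable.
    - move=> i j ij; apply/subsetPset; apply: setSI.
      by apply/subsetPset; exact: niF.
  have {}G0 : fine (leb2 (G n)) @[n --> \oo] --> (0 : R) by exact: fine_cvg G0.
  have m_G n e : 0 < e -> m (F n) <= 2 * K * e + e ^- 2 * fine (leb2 (G n)).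
    move=> e0; rewrite m_tileI// -lee_fin EFinD (EFinM (e ^- 2)) fineK.
      exact: (m_ac _ _ e0 (mG n)).
    by rewrite ge0_fin_numE// (le_lt_trans _ X_fin)// measureIr.
  apply/cvgrPdist_le => eps eps0.
  have K1 : 0 < 4 * K + 2 by rewrite ltr_wpDl// mulr_ge0.
  (* First [e] is fixed so that [2 * K * e <= eps / 2]; then [n] is taken large enough that the area
     term is at most [eps / 2]. *)
  pose e := eps / (4 * K + 2).
  have e0 : 0 < e by rewrite divr_gt0.
  have d0 : 0 < e ^+ 2 * (eps / 2) by rewrite mulr_gt0 ?exprn_gt0// divr_gt0.
  move/cvgrPdist_le : G0 => /(_ _ d0) [N _ hN]; exists N => // n /hN /=.
  rewrite !sub0r !normrN ger0_norm ?fine_ge0// => h.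
  have m0 : 0 <= m (F n) by case: (pm) => + _ _; apply.
  rewrite ger0_norm// (le_trans (m_G n e e0))//.
  have h1 : e ^- 2 * fine (leb2 (G n)) <= eps / 2.
    by rewrite ler_pdivrMl ?exprn_gt0.
  have h2 : 2 * K * e <= eps / 2.
    have -> : eps / 2 = (2 * K + 1) * e by rewrite /e; field; rewrite gt_eqF.
    by move: (e0); lra.
  lra.
have [P PE] := content_probability pm cont.
exists P; split.
- by rewrite PE// m_tile.
- by move=> A mA; rewrite !PE ?m_inv//; exact: mT.
- move=> A mA A0; rewrite PE//; congr EFin; apply/eqP; rewrite eq_le.
  apply/andP; split; last by case: pm => m0 _ _; exact: m0.
  apply/ler_addgt0Pr => e e0; rewrite add0r.
  have K1 : 0 < 2 * K + 1 by rewrite ltr_wpDl// mulr_ge0.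
  have := m_ac A (e / (2 * K + 1)) (divr_gt0 e0 K1) mA.
  rewrite A0 mule0 adde0 lee_fin => h; apply: (le_trans h).
  by rewrite mulrA ler_pdivrMr//; move: (e0); lra.
Qed.
End existence.

(** * Continuity of translations *)

Section translation_continuity.
Variable R : realType.
Local Notation plane := (plane R).
Local Notation leb2 := (@lebesgue2 R).
Implicit Types (A : set plane) (v : plane).

Definition shift_diff v A : set plane :=
  (A `\` translate v @^-1` A) `|` (translate v @^-1` A `\` A).

Lemma measurable_shift_diff v A : measurable A -> measurable (shift_diff v A).
Proof.
move=> mA; have mB := measurable_translate_preimage v mA.
by apply: measurableU; exact: measurableD.
Qed.

Variables (r : R) (r0 : 0 < r).
Local Notation B := (box (- r) r (- r) r).
(** The margin 1 keeps every translate of [B] by a vector shorter than 1 inside [B']. *)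
Local Notation B' := (box (- (r + 1)) (r + 1) (- (r + 1)) (r + 1)).

(** Local L1 continuity of the indicator of [A] under translations. It is proved for all Borel sets
    by showing that the sets having it form a sigma-algebra that contains the rectangles. *)
Definition shift_continuous A := measurable A /\
  forall e : R, 0 < e -> exists2 del : R, 0 < del &
    forall v, nrm v < del -> (leb2 (B `&` shift_diff v A) <= e%:E)%E.

Let mB : measurable B. Proof. exact: measurable_box. Qed.
Let mB' : measurable B'. Proof. exact: measurable_box. Qed.

Lemma shift_continuousC A : shift_continuous A -> shift_continuous (~` A).
Proof.
move=> [mA cA]; split; first exact: measurableC.
move=> e e0; have [del del0 h] := cA _ e0; exists del => // v /h.
congr (leb2 (_ `&` _) <= _)%E.
by rewrite /shift_diff preimage_setC !setDE !setCK setUC setIC [X in _ = _ `|` X]setIC.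
Qed.

Lemma tail_box_small (F : nat -> set plane) (e : R) :
  (forall i, measurable (F i)) -> 0 < e -> exists n,
  (leb2 (B' `&` (\bigcup_n F n `\` \big[setU/set0]_(i < n) F i)) <= e%:E)%E.
Proof.
move=> mF e0; have rp := r0.
pose G n := B' `&` (\bigcup_n F n `\` \big[setU/set0]_(i < n) F i).
have mG n : measurable (G n).
  apply: measurableI => //; apply: measurableD; first exact: bigcupT_measurable.
  exact: bigsetU_measurable.
have G0 : leb2 (G n) @[n --> \oo] --> 0%:E.
  have <- : leb2 (\bigcap_n G n) = 0%:E.
    rewrite (_ : \bigcap_n G n = set0) ?measure0//.
    apply/seteqP; split => // p Gp; have [_ [[i _ Fi] _]] := Gp 0%N I.
    have [_ [_]] := Gp i.+1 I; apply; rewrite -bigcup_mkord.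
    by exists i => /=.
  apply: nonincreasing_cvg_mu => //.
  - apply: (@le_lt_trans _ _ (leb2 B')); last by rewrite lebesgue2_box ?ltry//; lra.
    by apply: measureIl => //; apply: measurableD;
      [exact: bigcupT_measurable|exact: bigsetU_measurable].
  - exact: bigcapT_measurable.
  - move=> i j ij; apply/subsetPset; apply: setIS; apply: setDS.
    by rewrite -!bigcup_mkord => x [k /= ki Fk]; exists k => //=; exact: leq_trans ij.
have {}G0 : fine (leb2 (G n)) @[n --> \oo] --> (0 : R) by exact: fine_cvg G0.
move/cvgrPdist_le : G0 => /(_ _ e0) [N _ hN]; exists N.
have := hN N (leqnn N); rewrite /= sub0r normrN ger0_norm ?fine_ge0//.
rewrite -lee_fin fineK// ge0_fin_numE//.
apply: (@le_lt_trans _ _ (leb2 B')); last by rewrite lebesgue2_box ?ltry//; lra.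
by apply: measureIl => //; apply: measurableD;
  [exact: bigcupT_measurable|exact: bigsetU_measurable].
Qed.

Lemma shift_continuous_finU (F : nat -> set plane) n e :
  (forall i, shift_continuous (F i)) -> 0 < e ->
  exists2 del : R, 0 < del & forall v, nrm v < del ->
    (leb2 (B `&` \big[setU/set0]_(i < n) shift_diff v (F i)) <= e%:E)%E.
Proof.
move=> cF; elim: n e => [|n ih] e e0.
  exists 1 => // v _; rewrite big_ord0 setI0 measure0 lee_fin; exact: ltW.
have e2 : 0 < e / 2 by rewrite divr_gt0.
have [d1 d10 h1] := ih _ e2; have [d2 d20 h2] := (cF n).2 _ e2.
exists (Num.min d1 d2); first by rewrite lt_min d10.
move=> v; rewrite lt_min => /andP[/h1 {}h1 /h2 {}h2].
have mD i : measurable (shift_diff v (F i)).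
  by apply: measurable_shift_diff; exact: (cF i).1.
rewrite big_ord_recr/= setIUr.
have m1 : measurable (B `&` \big[setU/set0]_(i < n) shift_diff v (F i)).
  by apply: measurableI => //; exact: bigsetU_measurable.
have m2 : measurable (B `&` shift_diff v (F n)) by exact: measurableI.
apply: (le_trans (measureU2 _ m1 m2)); apply: (le_trans (leeD h1 h2)).
by rewrite -EFinD -splitr.
Qed.

Lemma shift_continuous_bigcup (F : nat -> set plane) :
  (forall i, shift_continuous (F i)) -> shift_continuous (\bigcup_i F i).
Proof.
have rp := r0; move=> cF; have mF i : measurable (F i) by exact: (cF i).1.
have mU := bigcupT_measurable F mF.
(* One third each for the first [n] sets, for the tail of the union at a point, and for the tail at
   the translated point. *)
split => // e e0; have e3 : 0 < e / 3 by rewrite divr_gt0.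
have [n hn] := tail_box_small mF e3.
have [del del0 h] := shift_continuous_finU n cF e3.
exists (Num.min del 1); first by rewrite lt_min del0 ltr01.
move=> v; rewrite lt_min => /andP[/h {}h v1].
set G := _ `\` _ in hn.
have mbig : measurable (\big[setU/set0]_(i < n) F i) by exact: bigsetU_measurable.
have mG : measurable G by exact: measurableD.
set D := \big[setU/set0]_(i < n) _ in h.
have mD : measurable D.
  by apply: bigsetU_measurable => i _; exact: measurable_shift_diff.
have mBD : measurable (B `&` D) by exact: measurableI.
have mB'G : measurable (B' `&` G) by exact: measurableI.
have mtG := measurable_translate_preimage v mB'G.
have sub : B `&` shift_diff v (\bigcup_i F i) `<=`
    (B `&` D) `|` ((B' `&` G) `|` translate v @^-1` (B' `&` G)).
  have BB' : B `<=` B'.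
    by move=> p; rewrite /box/= !in_itv/= => -[]; lra.
  have tBB' p : B p -> B' (translate v p).
    have := le_lt_trans (ler_fst_nrm v) v1; have := le_lt_trans (ler_snd_nrm v) v1.
    rewrite !ltr_norml /box/= !in_itv/= => ? ? [].
    by split; lra.
  have in_D i p : (i < n)%N -> shift_diff v (F i) p -> D p.
    by move=> i_n Dp; rewrite /D -(bigcup_mkord n (fun i => shift_diff v (F i))); exists i.
  move=> p [Bp [[[i _ Fi] nU]|[[i _ Fi] nU]]].
    have [|nbig] := pselect ((\big[setU/set0]_(i < n) F i) p).
      rewrite -bigcup_mkord => -[k /= k_n Fk]; left; split => //.
      by apply: (in_D k) => //; left; split => // Fk'; apply: nU; exists k.
    by right; left; split; [exact: BB'|split => //; exists i].
  have [|nbig] := pselect ((\big[setU/set0]_(i < n) F i) (translate v p)).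
    rewrite -bigcup_mkord => -[k /= k_n Fk]; left; split => //.
    by apply: (in_D k) => //; right; split => // Fk'; apply: nU; exists k.
  by right; right; split; [exact: tBB'|split => //; exists i].
have htG : (leb2 (translate v @^-1` (B' `&` G)) <= (e / 3)%:E)%E.
  by rewrite lebesgue2_translate.
have mU' : measurable ((B' `&` G) `|` translate v @^-1` (B' `&` G)) by exact: measurableU.
apply: (@le_trans _ _ (leb2 ((B `&` D) `|`
    ((B' `&` G) `|` translate v @^-1` (B' `&` G))))).
  apply: le_measure; rewrite ?inE//; last exact: measurableU.
  by apply: measurableI => //; exact: measurable_shift_diff.
apply: (le_trans (measureU2 _ mBD mU')).
apply: (@le_trans _ _ ((e / 3)%:E + ((e / 3)%:E + (e / 3)%:E))%E).
  apply: leeD => //; apply: (le_trans (measureU2 _ mB'G mtG)); exact: leeD.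
by rewrite -!EFinD lee_fin; lra.
Qed.

Lemma shift_continuous_sigma : sigma_algebra setT shift_continuous.
Proof.
split => [|A cA|F cF]; last exact: shift_continuous_bigcup.
  split => // e e0; exists 1 => // v _.
  by rewrite /shift_diff preimage_set0 !set0D setU0 setI0 measure0 lee_fin ltW.
by rewrite setTD; exact: shift_continuousC.
Qed.

Lemma strip1_bound (c t : R) : 0 <= t ->
  (leb2 (B `&` ((fun p : plane => p.1) @^-1` `[(c - t)%R, (c + t)%R]%classic)) <=
    (4 * r * t)%:E)%E.
Proof.
move=> t0; apply: (@le_trans _ _ (leb2 (box (c - t) (c + t) (- r) r))).
  apply: le_measure; rewrite ?inE//.
  - by apply: measurableI => //; rewrite -[X in measurable X]setTI; exact: measurable_fst.
  - exact: measurable_box.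
  - by move=> p [[_ p2]].
have rp := r0; rewrite lebesgue2_box; [rewrite lee_fin; lra|lra|lra].
Qed.

Lemma strip2_bound (c t : R) : 0 <= t ->
  (leb2 (B `&` ((fun p : plane => p.2) @^-1` `[(c - t)%R, (c + t)%R]%classic)) <=
    (4 * r * t)%:E)%E.
Proof.
move=> t0; apply: (@le_trans _ _ (leb2 (box (- r) r (c - t) (c + t)))).
  apply: le_measure; rewrite ?inE//.
  - by apply: measurableI => //; rewrite -[X in measurable X]setTI; exact: measurable_snd.
  - exact: measurable_box.
  - by move=> p [[p1 _]].
have rp := r0; rewrite lebesgue2_box; [rewrite lee_fin; lra|lra|lra].
Qed.

(** For an interval, a point and its translate can disagree only within [nrm v] of one of the two
    endpoints, that is, in two strips of area at most [4 * r * nrm v] each. The sigma-algebra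
    property extends this to Borel sets. *)
Lemma shift_continuous_coord (f : plane -> R) :
  measurable_fun setT f ->
  (forall p v, `|f (translate v p) - f p| <= nrm v) ->
  (forall c t : R, 0 <= t ->
    (leb2 (B `&` (f @^-1` `[(c - t)%R, (c + t)%R]%classic)) <= (4 * r * t)%:E)%E) ->
  forall A : set R, measurable A -> shift_continuous (f @^-1` A).
Proof.
move=> mf flip fstrip A mA; have rp := r0.
have mfA C : measurable C -> measurable (f @^-1` C).
  by move=> mC; rewrite -[X in measurable X]setTI; exact: mf.
suff : <<s @ocitv R >> `<=` [set C : set R | shift_continuous (f @^-1` C)].
  exact.
apply: smallest_sub.
  have [c0 cC cU] := shift_continuous_sigma; split => /=.
  - by rewrite preimage_set0.
  - by move=> C cfC; rewrite setTD preimage_setC -setTD; exact: cC.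
  - by move=> F cF; rewrite preimage_bigcup; exact: cU.
move=> _ [[x y] _ <-]; split; first exact: mfA.
move=> e e0; exists (e / (8 * r)); first by rewrite divr_gt0// mulr_gt0.
move=> v ve; have n0 := nrm_ge0 v.
have mstrip c : measurable (B `&` (f @^-1` `[(c - nrm v)%R, (c + nrm v)%R]%classic)).
  by apply: measurableI => //; exact: mfA.
apply: (@le_trans _ _ (leb2 ((B `&` (f @^-1` `[(x - nrm v)%R, (x + nrm v)%R]%classic)) `|`
    (B `&` (f @^-1` `[(y - nrm v)%R, (y + nrm v)%R]%classic))))).
  apply: le_measure; rewrite ?inE//.
  - by apply: measurableI => //; apply: measurable_shift_diff; exact: mfA.
  - exact: measurableU.
  - rewrite -setIUr; apply: setIS => p; have := flip p v; rewrite ler_norml.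
    move=> /andP[h1 h2] [[]|[]]; rewrite /= !in_itv/= => /andP[h3 h4] /negP;
      rewrite negb_and -leNgt -ltNge => /orP[h5|h5].
    + by left; apply/andP; split; lra.
    + by right; apply/andP; split; lra.
    + by left; apply/andP; split; lra.
    + by right; apply/andP; split; lra.
apply: (le_trans (measureU2 _ (mstrip x) (mstrip y))).
apply: (le_trans (leeD (fstrip _ _ n0) (fstrip _ _ n0))).
rewrite -EFinD lee_fin.
by move: ve; rewrite ltr_pdivlMr ?mulr_gt0//; lra.
Qed.

Lemma measurable_shift_continuous A : measurable A -> shift_continuous A.
Proof.
suff : <<s [set C `*` D | C in measurable & D in measurable] >> `<=` shift_continuous.
  by move=> + mA; apply; rewrite -measurable_prod_measurableType.
apply: smallest_sub; first exact: shift_continuous_sigma.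
move=> _ [C mC [D mD <-]].
have cC : shift_continuous ((fun p : plane => p.1) @^-1` C).
  apply: shift_continuous_coord => //; first exact: measurable_fst.
  - by move=> p v; rewrite /translate/= addrAC subrr add0r ler_fst_nrm.
  - exact: strip1_bound.
have cD : shift_continuous ((fun p : plane => p.2) @^-1` D).
  apply: shift_continuous_coord => //; first exact: measurable_snd.
  - by move=> p v; rewrite /translate/= addrAC subrr add0r ler_snd_nrm.
  - exact: strip2_bound.
(* De Morgan: the intersection is reduced to complements and a countable union whose later terms all
   repeat the second set. *)
rewrite (_ : C `*` D = ~` \bigcup_i (if i is 0%N then ~` ((fun p : plane => p.1) @^-1` C)
    else ~` ((fun p : plane => p.2) @^-1` D))).
  apply: shift_continuousC; apply: shift_continuous_bigcup => -[|i];
    exact: shift_continuousC.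
apply/seteqP; split => [p [Cp Dp] [[|i] _]|p h]; first exact.
  exact.
split; apply: contrapT => n; apply: h; first by exists 0%N.
by exists 1%N.
Qed.

Lemma translation_continuity A (e : R) : measurable A -> A `<=` B -> 0 < e ->
  exists2 del : R, 0 < del & forall v, nrm v < del ->
    (leb2 (A `\` translate v @^-1` A) <= e%:E)%E.
Proof.
move=> mA AB e0; have [_ /(_ _ e0)[del del0 h]] := measurable_shift_continuous mA.
exists del => // v /h; apply: le_trans; have mtA := measurable_translate_preimage v mA.
apply: le_measure; rewrite ?inE.
- exact: measurableD.
- by apply: measurableI => //; exact: measurable_shift_diff.
- by move=> p [Ap nAp]; split; [exact: AB|left].
Qed.

End translation_continuity.

(** * Invariant sets contain discs *)

Section linear_core.
Variables (R : realType) (a b : R).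
Hypothesis b0 : b != 0.
Local Notation plane := (plane R).
Local Notation leb2 := (@lebesgue2 R).
Local Notation xi := (xi a b).
Local Notation cmul := (cmul a b).
Local Notation cdiv := (cdiv a b).
Local Notation ell := (ell a b).
Local Notation slab := (slab a b).
Local Notation tmap := (tmap a b).
Local Notation beta := (abs_zeta a b).
Hypothesis beta2 : 2 < beta.

Let beta0 : 0 < beta. Proof. exact: lt_trans beta2. Qed.

Let mT A : measurable A -> measurable (tmap @^-1` A).
Proof. by move=> mA; rewrite -[X in measurable X]setTI; exact: measurable_tmap. Qed.

(** Multiplication by zeta factors as a shear, the swap and a shear, with Jacobians [|b|] and
    [(a^2 + b^2) / |b|]. *)
Lemma lebesgue2_cmul (A : set plane) : measurable A ->
  leb2 (cmul @^-1` A) = ((beta ^- 2)%:E * leb2 A)%E.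
Proof.
move=> mA; have N0 := norm2_gt0 a b0.
pose A1 : set plane := [set p | A (p.1, - (a / b) * p.1 + (a ^+ 2 + b ^+ 2) / b * p.2)].
have mA1 : measurable A1.
  rewrite -[X in measurable X]setTI.
  suff mf : measurable_fun setT (fun p : plane =>
      (p.1, - (a / b) * p.1 + (a ^+ 2 + b ^+ 2) / b * p.2) : plane) by exact: mf.
  apply: measurable_fun_pair; first exact: measurable_fst.
  by apply: measurable_funD; exact: measurable_funM.
pose A2 : set plane := [set p | A1 (p.2, p.1)].
have mA2 : measurable A2.
  rewrite -[X in measurable X]setTI.
  suff mf : measurable_fun setT (fun p : plane => (p.2, p.1) : plane) by exact: mf.
  exact: measurable_fun_pair.
have -> : cmul @^-1` A = [set p | A2 (p.1, a * p.1 + - b * p.2)].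
  apply/seteqP; split => p; rewrite /A2 /A1 /cmul/=; congr (A (_, _)).
  - ring.
  - by field.
  - ring.
  - by field.
have mf1 : measurable_fun setT (fun x : R => a * x) by exact: mulrl_measurable.
have mf2 : measurable_fun setT (fun x : R => - (a / b) * x) by exact: mulrl_measurable.
have bN0 : - b != 0 by rewrite oppr_eq0.
have d0 : (a ^+ 2 + b ^+ 2) / b != 0 by rewrite mulf_neq0 ?invr_neq0// lt0r_neq0.
rewrite (lebesgue2_shear bN0 mf1 mA2) lebesgue2_swap// (lebesgue2_shear d0 mf2 mA).
rewrite muleA -EFinM; congr (_%:E * _)%E.
rewrite normrN normrM normfV (gtr0_norm N0) sqr_beta//; field.
by rewrite normr_eq0 b0 gt_eqF.
Qed.

Lemma measurable_iter_cmul n : measurable_fun setT (iter n cmul).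
Proof.
elim: n => [|n ih]; first exact: measurable_id.
exact: (measurableT_comp (measurable_cmul a b) ih).
Qed.

Lemma lebesgue2_iter_cmul n (A : set plane) : measurable A ->
  leb2 (iter n cmul @^-1` A) = ((beta ^- 2 ^+ n)%:E * leb2 A)%E.
Proof.
elim: n A => [|n ih] A mA; first by rewrite expr0 mul1e.
have mC : measurable (cmul @^-1` A).
  by rewrite -[X in measurable X]setTI; exact: measurable_cmul.
rewrite (_ : iter n.+1 cmul @^-1` A = iter n cmul @^-1` (cmul @^-1` A))//.
by rewrite ih// lebesgue2_cmul// muleA -EFinM -exprSr.
Qed.

Lemma nrm_iter_cmul n p : nrm (iter n cmul p) = beta ^+ n * nrm p.
Proof.
elim: n => [|n ih]; first by rewrite expr0 mul1r.
by rewrite iterS nrm_cmul// ih exprS mulrA.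
Qed.

(** A bound for [|xi v|] over vectors [v] of length at most [rho / beta ^+ n]. *)
Definition edge_gap (rho : R) n : R := beta / `|b| * (rho / beta ^+ n).

(** Points around which the disc of radius [rho / beta ^+ n] meets no cut during [n] steps. The gap
    has index [k] because the disc of radius [rho / beta ^+ k.+1] is expanded to radius
    [rho / beta ^+ k] before the cut. *)
Fixpoint linear_core (rho : R) (n : nat) : set plane :=
  if n is k.+1 then
    [set z | edge_gap rho k <= frac (ell z) < 1 - edge_gap rho k /\
             linear_core rho k (tmap z)]
  else setT.

Lemma linear_core_translate rho n z h : linear_core rho n z ->
  nrm h < rho / beta ^+ n ->
  iter n tmap (translate h z) = translate (iter n cmul h) (iter n tmap z).
Proof.
elim: n z h => // n ih z h [/andP[g1 g2] cT] hn; rewrite !iterSr.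
have hn' : nrm (cmul h) < rho / beta ^+ n.
  rewrite nrm_cmul// -ltr_pdivlMl// (lt_le_trans hn)// exprS invfM.
  by rewrite mulrCA.
have xih : `|xi (cmul h)| < edge_gap rho n.
  rewrite (le_lt_trans (ler_xi_nrm a b0 _))// ltr_pM2l//.
  by rewrite divr_gt0// normr_gt0.
rewrite tmap_translate; first exact: ih.
move: xih; rewrite ltr_norml => /andP[]; lra.
Qed.

Lemma measurable_linear_core rho n : measurable (linear_core rho n).
Proof.
elim: n => [|n ih]; first exact: measurableT.
have -> : linear_core rho n.+1 =
    (slab (1 - edge_gap rho n) `\` slab (edge_gap rho n)) `&`
    (tmap @^-1` linear_core rho n).
  apply/seteqP; split => z /=; rewrite /slab/=.
    by move=> [/andP[g1 g2] c]; split => //; split => //; apply/negP; rewrite -leNgt.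
  by move=> [[g1 /negP g2] c]; split => //; rewrite g1 andbT leNgt.
by apply: measurableI; [apply: measurableD; exact: measurable_slab|exact: mT].
Qed.

Lemma edge_mass K m eta : 0 <= K -> regular K m -> 0 <= eta ->
  m (~` (slab (1 - eta) `\` slab eta)) <= (3 * K + 4) * eta.
Proof.
move=> K0 [pm mK] eta0.
have m1 := measurable_slab a b eta; have m2 := measurable_slab a b (1 - eta).
have m2C := measurableC m2.
have [eta1|eta1] := leP eta 1; last first.
  rewrite (le_trans (prob_content_le1 pm (measurableC (measurableD m2 m1))))//.
  have : 0 <= K * eta by rewrite mulr_ge0.
  lra.
(* This [w] satisfies [xi (cmul w) = eta] with length at most [eta], so the two slab bounds give
   [(K + 2) * eta] and [(2 * K + 2) * eta]. *)
pose w : plane := cdiv (eta, 0).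
have xw : xi (cmul w) = eta by rewrite /w cdivK// /xi/= mulr0 addr0.
have nw : nrm w <= eta.
  rewrite nrm_cdiv// /nrm/= expr0n/= addr0 sqrtr_sqr ger0_norm//.
  by rewrite ler_pdivrMr// ler_peMr// ltW// (lt_trans _ beta2)// ltr1n.
have := slab_bound (a := a) (b := b) pm (mK w); rewrite xw eta0 eta1 => /(_ isT) h1.
have := slab_boundC (a := a) (b := b) pm (mK w); rewrite xw eta0 eta1 => /(_ isT) h2.
have -> : ~` (slab (1 - eta) `\` slab eta) = ~` slab (1 - eta) `|` slab eta.
  by rewrite setDE setCI setCK.
rewrite (le_trans (prob_contentU pm m2C m1))//.
have : K * nrm w <= K * eta by rewrite ler_wpM2l.
lra.
Qed.

(** Every push-forward is regular with the same [K], so [edge_mass] applies at each step. As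
    [beta > 2], the gaps are dominated by a geometric series, and [2 - 2 / 2 ^+ n] is the sum of the
    [1 / 2 ^+ k] for [k < n]. *)
Lemma linear_core_mass K m rho n : 0 <= K ->
  2 * (beta / `|b|) <= K * (1 - 2 / beta) ->
  regular K m -> 0 <= rho ->
  m (~` linear_core rho n) <=
    (3 * K + 4) * (beta / `|b|) * rho * (2 - 2 / 2 ^+ n).
Proof.
move=> K0 hK + rho0; elim: n m => [|n ih] m rm.
  by rewrite /= setCT prob_content0; [rewrite expr0 divr1 subrr mulr0|case: rm].
have [pm _] := rm.
have -> : ~` linear_core rho n.+1 =
    ~` (slab (1 - edge_gap rho n) `\` slab (edge_gap rho n)) `|`
    (tmap @^-1` (~` linear_core rho n)).
  rewrite preimage_setC -setCI; congr (~` _).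
  apply/seteqP; split => z /=; rewrite /slab/=.
    by move=> [/andP[g1 g2] c]; split => //; split => //; apply/negP; rewrite -leNgt.
  by move=> [[g1 /negP g2] c]; split => //; rewrite g1 andbT leNgt.
have mc := measurable_linear_core rho n.
have bb : 0 < beta / `|b| by rewrite divr_gt0// normr_gt0.
have g0 : 0 <= edge_gap rho n.
  by rewrite mulr_ge0 ?(ltW bb)// divr_ge0// exprn_ge0// ltW.
apply: (le_trans (prob_contentU pm _ _)).
- by apply: measurableC; apply: measurableD; exact: measurable_slab.
- by apply: mT; exact: measurableC.
have h1 := edge_mass K0 rm g0.
have h2 := ih _ (regular_tmap b0 hK rm).
apply: (le_trans (lerD h1 h2)).
have : edge_gap rho n <= beta / `|b| * (rho / 2 ^+ n).
  rewrite /edge_gap ler_wpM2l ?(ltW bb)// ler_wpM2l// lef_pV2 ?posrE ?exprn_gt0//.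
  by rewrite lerXn2r ?nnegrE// ltW.
have K1 : 0 <= 3 * K + 4 by rewrite addr_ge0// mulr_ge0.
move=> /(ler_wpM2l K1) h3; apply: (le_trans (lerD h3 (lexx _))).
rewrite le_eqVlt; apply/orP; left; apply/eqP.
rewrite exprS; field.
by rewrite expf_neq0//= normr_eq0.
Qed.

End linear_core.

(** * Discs and the part of a disc outside a set *)

Section discs.
Variable R : realType.
Local Notation plane := (plane R).
Local Notation leb2 := (@lebesgue2 R).

Lemma measurable_nrm : measurable_fun setT (@nrm R).
Proof.
have ms : measurable_fun setT (@Num.sqrt R).
  by apply: nondecreasing_measurable => // x y xy; exact: ler_wsqrtr.
apply: (measurableT_comp ms); apply: measurable_funD; apply: measurable_funX.
  exact: measurable_fst.
exact: measurable_snd.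
Qed.

(** The triangle inequality, from Cauchy-Schwarz in the form of Lagrange's identity. *)
Lemma ler_nrm_translate v p : nrm (translate v p) <= nrm p + nrm v :> R.
Proof.
rewrite -[leRHS]ger0_norm ?addr_ge0 ?nrm_ge0// -sqrtr_sqr ler_wsqrtr//.
rewrite /nrm [leRHS]sqrrD !sqr_sqrtr ?addr_ge0 ?sqr_ge0// /translate/=.
have := @ler_abs_sqrt R (p.1 * v.1 + p.2 * v.2)
  ((p.1 ^+ 2 + p.2 ^+ 2) * (v.1 ^+ 2 + v.2 ^+ 2)).
rewrite -subr_ge0 (_ : _ - _ = (p.1 * v.2 - p.2 * v.1) ^+ 2); last ring.
rewrite sqr_ge0 => /(_ isT); rewrite sqrtrM ?addr_ge0 ?sqr_ge0//.
by have := ler_norm (p.1 * v.1 + p.2 * v.2 : R); lra.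
Qed.

Definition disc (rho : R) : set plane := [set h | nrm h < rho].

Lemma measurable_disc rho : measurable (disc rho).
Proof.
have -> : disc rho = (@nrm R) @^-1` `]-oo, rho[%classic.
  by apply/seteqP; split => h; rewrite /disc/= in_itv.
by rewrite -[X in measurable X]setTI; exact: measurable_nrm.
Qed.

Lemma lebesgue2_disc_lty rho : (leb2 (disc rho) < +oo)%E.
Proof.
have [rho0|rho0] := leP rho 0.
  rewrite (_ : disc rho = set0) ?measure0//; apply/seteqP; split => // h.
  by rewrite /disc/= => /lt_le_trans/(_ rho0); rewrite ltNge nrm_ge0.
apply: (@le_lt_trans _ _ (leb2 (box (- rho) rho (- rho) rho))); last first.
  by rewrite lebesgue2_box ?ltry//; lra.
apply: le_measure; rewrite ?inE.
- exact: measurable_disc.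
- exact: measurable_box.
- move=> h; rewrite /disc /box/= !in_itv/= => hr; rewrite -!ler_norml.
  by split; apply: ltW; rewrite (le_lt_trans _ hr)// ?ler_fst_nrm// ler_snd_nrm.
Qed.

Lemma lebesgue2_disc_gt0 rho : 0 < rho -> (0 < leb2 (disc rho))%E.
Proof.
move=> rho0; pose s := rho / 3.
have s0 : 0 < s by rewrite divr_gt0.
have : (leb2 (box (- s) s (- s) s) <= leb2 (disc rho))%E.
  apply: le_measure; rewrite ?inE.
  - exact: measurable_box.
  - exact: measurable_disc.
  - move=> h; rewrite /disc /box/= !in_itv/= -!ler_norml => -[h1 h2].
    rewrite (le_lt_trans (ler_nrm h))// (le_lt_trans (lerD h1 h2))// /s; lra.
apply: lt_le_trans; rewrite lebesgue2_box ?lte_fin; [|lra|lra].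
by rewrite mulr_gt0; lra.
Qed.

(** Recentred at the origin, so that discs around different points can be compared and rescaled by
    [cmul]. *)
Definition missing (C : set plane) (c : plane) (rho : R) : set plane :=
  [set h | nrm h < rho /\ ~ C (translate h c)].

Lemma measurable_missing C c rho : measurable C -> measurable (missing C c rho).
Proof.
move=> mC; have -> : missing C c rho = disc rho `&` ~` (translate c @^-1` C).
  by apply/seteqP; split => h; rewrite /missing/= translateC.
apply: measurableI; first exact: measurable_disc.
by apply: measurableC; exact: measurable_translate_preimage.
Qed.

(** Double counting of the pairs [(z, v)] with [z] in [C], [v] in the disc and [z + v] outside [C]:
    integrating over [z] first gives at most [e * leb2 (disc rho)], whereas large missing parts at
    all [z] in [G] would give at least [t * k]. *)
Lemma exists_small_missing (C G : set plane) (rho t e k : R) :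
  measurable C -> measurable G -> G `<=` C -> 0 <= t -> 0 <= e ->
  (k%:E <= leb2 G)%E ->
  (forall v, nrm v < rho -> (leb2 (C `\` translate v @^-1` C) <= e%:E)%E) ->
  (e%:E * leb2 (disc rho) < t%:E * k%:E)%E ->
  exists2 z, G z & (leb2 (missing C z rho) <= t%:E)%E.
Proof.
move=> mC mG GC t0 e0 kG Cv lt_et.
apply: contrapT => nex.
have gt_t z : G z -> (t%:E <= leb2 (missing C z rho))%E.
  by move=> Gz; rewrite leNgt; apply/negP => lt; apply: nex; exists z => //; exact: ltW.
pose W := [set w : plane * plane | C w.1 /\ disc rho w.2 /\ ~ C (translate w.2 w.1)].
have mW : measurable W.
  have m1 : measurable [set w : plane * plane | C w.1].
    rewrite -[X in measurable X]setTI.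
    suff mf : measurable_fun setT (fun w : plane * plane => w.1) by exact: mf.
    exact: measurable_fst.
  have m2 : measurable [set w : plane * plane | disc rho w.2].
    rewrite -[X in measurable X]setTI; have := measurable_disc rho.
    suff mf : measurable_fun setT (fun w : plane * plane => w.2) by exact: mf.
    exact: measurable_snd.
  have m3 := measurableC (measurable_sum_preimage mC).
  exact: (measurableI _ _ m1 (measurableI _ _ m2 m3)).
have mx : measurable_fun setT (fun z => leb2 (xsection W z)).
  exact: (measurable_fun_xsection (@sigma_finite_lebesgue2 R) mW).
have my : measurable_fun setT (fun z => leb2 (ysection W z)).
  exact: (measurable_fun_ysection (@sigma_finite_lebesgue2 R) mW).
have t0' : (0 <= t%:E :> \bar R)%E by rewrite lee_fin.
have e0' : (0 <= e%:E :> \bar R)%E by rewrite lee_fin.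
have le1 : (t%:E * k%:E <= \int[leb2]_z leb2 (xsection W z))%E.
  apply: (@le_trans _ _ (\int[leb2]_(z in G) leb2 (xsection W z))%E); last first.
    exact: ge0_subset_integral.
  apply: (@le_trans _ _ (\int[leb2]_(z in G) t%:E)%E).
    by rewrite integral_cst// lee_wpmul2l.
  apply: ge0_le_integral => //; first exact: measurable_funTS.
  move=> z Gz; rewrite (le_trans (gt_t z Gz))// le_eqVlt; apply/orP; left.
  apply/eqP; congr (leb2 _); apply/seteqP; split => h; rewrite /xsection/= inE.
    by move=> [h1 h2]; split; [exact: GC|].
  by move=> [_ [h1 h2]].
have le2 : (\int[leb2]_z leb2 (ysection W z) <= e%:E * leb2 (disc rho))%E.
  have md := measurable_disc rho.
  rewrite -integral_cst// [leRHS]integral_mkcond.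
  apply: ge0_le_integral => //.
    by apply/(measurable_restrictT _ md); exact: measurable_cst.
  move=> v _; rewrite patchE; have [dv|dv] := pselect (disc rho v); last first.
    rewrite memNset//.
    rewrite (_ : ysection W v = set0) ?measure0//.
    by apply/seteqP; split => // z; rewrite /ysection/= inE => -[_ []].
  rewrite mem_set//; apply: le_trans (Cv v dv); rewrite le_eqVlt; apply/orP; left.
  apply/eqP; congr (leb2 _); apply/seteqP; split => z; rewrite /ysection/= inE.
    by move=> [h1 [h2 h3]].
  by move=> [h1 h2].
have := fubini_sections (@sigma_finite_lebesgue2 R) (@sigma_finite_lebesgue2 R) mW.
move=> fub; have := lt_le_trans lt_et le1; rewrite [X in (_ < X)%E]fub.
by move=> /lt_le_trans/(_ le2); rewrite ltxx.
Qed.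

End discs.

Section invariant_disc.
Variables (R : realType) (a b : R).
Hypothesis b0 : b != 0.
Local Notation plane := (plane R).
Local Notation leb2 := (@lebesgue2 R).
Local Notation cmul := (cmul a b).
Local Notation tmap := (tmap a b).
Local Notation beta := (abs_zeta a b).
Hypothesis beta2 : 2 < beta.

Variable C : set plane.
Hypotheses (mC : measurable C) (C_tile : C `<=` tile_coords a b).
Hypothesis C_inv : forall z, C z -> C (tmap z).
Hypothesis C_gt0 : (0 < leb2 C)%E.

Let r : R := 1 + `|a| + `|b|.

Let r0 : 0 < r.
Proof. by rewrite /r -addrA ltr_wpDr// addr_ge0. Qed.

Let beta0 : 0 < beta. Proof. exact: lt_trans beta2. Qed.

Let tile_box : tile_coords a b `<=` box (- r) r (- r) r.
Proof.
move=> p /(tile_coords_box b0); rewrite /box/= !in_itv/= /r.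
have := normr_ge0 a; have := normr_ge0 b => ? ? [/andP[? ?] /andP[? ?]].
by split; apply/andP; split; lra.
Qed.

Lemma expr_large (x : R) : exists n, x < beta ^+ n.
Proof.
exists (Num.truncn x).+1.
have [x0|x0] := leP x 0; first by rewrite (le_lt_trans x0)// exprn_gt0.
have /andP[_ xn] := truncn_itv (ltW x0); rewrite (lt_le_trans xn)//.
apply: (@le_trans _ _ (2 ^+ (Num.truncn x).+1)); last first.
  by rewrite lerXn2r ?nnegrE// ltW.
by rewrite -natrX ler_nat ltnW// ltn_expl.
Qed.

Lemma linear_core_large : exists2 rho : R, 0 < rho & exists2 k : R, 0 < k &
  forall n, (k%:E <= leb2 (C `&` linear_core a b rho n))%E.
Proof.
have [K K0 [hK rm]] : exists2 K : R, 0 <= K &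
    2 * (beta / `|b|) <= K * (1 - 2 / beta) /\ regular K (iter_content a b r0 0).
  exists (regular_const a b r); first exact: regular_const_ge0.
  by split; [exact: regular_const_ge|exact: iter_content_regular].
set m := iter_content a b r0 0 in rm.
have [pm _] := rm.
have mE A : measurable A -> A `<=` C -> (m A)%:E = (((2 * r) ^- 2)%:E * leb2 A)%E.
  move=> mA AC; rewrite /m /iter_content (probability_fineK (uniform_box r0))//.
  rewrite [LHS]uniform_boxE (_ : A `&` _ = A)//.
  by apply/seteqP; split => [p []|p Ap]//; split => //; exact/tile_box/C_tile/AC.
clearbody m.
have q0 : 0 < (2 * r) ^- 2 by rewrite invr_gt0 exprn_gt0// mulr_gt0.
have mC0 : 0 < m C by rewrite -lte_fin mE// mule_gt0.
have D0 : 0 < (3 * K + 4) * (beta / `|b|).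
  by rewrite mulr_gt0// ?divr_gt0 ?normr_gt0// ltr_wpDl// mulr_ge0.
set D := (3 * K + 4) * (beta / `|b|) in D0.
(* With this radius the mass outside the core is at most [2 * D * rho = m C / 2] for every [n]; the
   next witness is the remaining mass converted into area. *)
exists (m C / (4 * D)); first by rewrite divr_gt0// mulr_gt0.
exists (m C / 2 / (2 * r) ^- 2); first by rewrite !divr_gt0.
move=> n; set G := linear_core _ _ _ _.
have mG : measurable G by exact: measurable_linear_core.
have mCG : measurable (C `&` G) by exact: measurableI.
have h : m (~` G) <= m C / 2.
  have rho0 : 0 <= m C / (4 * D) by rewrite divr_ge0 ?(ltW mC0)// mulr_ge0// ltW.
  have lcm := linear_core_mass b0 beta2 n K0 hK rm rho0.
  apply: (le_trans lcm).
  rewrite -/D (_ : D * (m C / (4 * D)) = m C / 4); last by field; rewrite gt_eqF.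
  have : 0 <= m C / 4 * (2 / 2 ^+ n) by rewrite mulr_ge0// divr_ge0// ltW.
  lra.
have h2 : m C <= m (C `&` G) + m (~` G).
  have mGC := measurableC mG.
  rewrite (le_trans _ (prob_contentU pm mCG mGC))// le_prob_content//.
    exact: measurableU.
  by move=> p Cp; have [?|?] := pselect (G p); [left|right].
have h3 : m C / 2 <= m (C `&` G) by lra.
rewrite EFinM -(@lee_pmul2l _ (((2 * r) ^- 2))%:E)// -mE//.
by rewrite -!EFinM lee_fin mulrCA mulfV ?mulr1// gt_eqF.
Qed.

(** Blow-up: translations of length below [rho / beta ^+ n] barely change [C], so some core point of
    [C] misses little of its disc of that radius. The [n]-th iterate is affine there, magnifies the
    disc to radius [rho], and keeps [C] inside itself. *)
Lemma almost_disc (rho k eps : R) : 0 < rho -> 0 < k ->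
  (forall n, (k%:E <= leb2 (C `&` linear_core a b rho n))%E) -> 0 < eps ->
  exists2 c, C c & (leb2 (missing C c rho) <= eps%:E)%E.
Proof.
move=> rho0 k0 hk eps0.
have dfin : leb2 (disc rho) \is a fin_num by rewrite ge0_fin_numE// lebesgue2_disc_lty.
pose L := fine (leb2 (disc rho)).
have L0 : 0 < L by rewrite fine_gt0// lebesgue2_disc_lty lebesgue2_disc_gt0.
(* Then [e * L = eps * k / 2]; the scale factor [beta ^- 2 ^+ n] appears on both sides of the final
   comparison, so [e] does not depend on [n]. *)
pose e := eps * k / (2 * L).
have e0 : 0 < e by rewrite divr_gt0 ?mulr_gt0.
have [del del0 hdel] := translation_continuity r0 mC (subset_trans C_tile tile_box) e0.
have [n hn] := expr_large (rho / del).
have bn0 : 0 < beta ^+ n by rewrite exprn_gt0.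
have q0 : 0 < beta ^- 2 ^+ n by rewrite exprn_gt0// invr_gt0 exprn_gt0.
have disc_n : leb2 (disc (rho / beta ^+ n)) = ((beta ^- 2 ^+ n) * L)%:E.
  rewrite EFinM fineK// -lebesgue2_iter_cmul//; last exact: measurable_disc.
  congr (leb2 _); apply/seteqP; split => h; rewrite /disc/= nrm_iter_cmul//;
    by rewrite ltr_pdivlMr// mulrC.
have [||||||z [Cz Gz] hz] := @exists_small_missing R C
    (C `&` linear_core a b rho n) (rho / beta ^+ n) (eps * beta ^- 2 ^+ n) e k
    mC _ _ _ _ (hk n) _ _.
- by apply: measurableI => //; exact: measurable_linear_core.
- by move=> p [].
- by rewrite mulr_ge0// ltW.
- exact: ltW.
- move=> v hv; apply: hdel; apply: (lt_trans hv).
  by rewrite ltr_pdivrMr// mulrC -ltr_pdivrMr.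
- rewrite disc_n -!EFinM lte_fin /e.
  rewrite (_ : _ * (_ * L) = eps * beta ^- 2 ^+ n * k / 2); last first.
    by field; rewrite gt_eqF.
  have : 0 < eps * beta ^- 2 ^+ n * k by rewrite !mulr_gt0.
  lra.
exists (iter n tmap z); first by elim: (n) => //= j; exact: C_inv.
have mM c s : measurable (missing C c s) by exact: measurable_missing.
rewrite -(@lee_pmul2l _ (beta ^- 2 ^+ n)%:E)//.
rewrite -lebesgue2_iter_cmul// -EFinM mulrC; apply: le_trans hz.
apply: le_measure; rewrite ?inE//.
  by rewrite -[X in measurable X]setTI; exact: measurable_iter_cmul.
move=> h [/=]; rewrite nrm_iter_cmul// => h1 h2.
have h1' : nrm h < rho / beta ^+ n by rewrite ltr_pdivlMr// mulrC.
split => // Czh; apply: h2; rewrite -(linear_core_translate b0 beta2 Gz h1').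
by elim: (n) => //= j; exact: C_inv.
Qed.

(** The centres found for [eps = 1 / (n + 1)] stay in a bounded box and converge along an
    ultrafilter. Halving the radius puts the limit disc inside the approximating ones, whose missing
    areas become arbitrarily small. *)
Lemma invariant_set_disc : exists c : plane, exists2 rho : R, 0 < rho &
  leb2 (missing C c rho) = 0%E.
Proof.
have [rho rho0 [k k0 hk]] := linear_core_large.
have /choice[u hu] n : exists c, C c /\ (leb2 (missing C c rho) <= (n.+1%:R^-1)%:E)%E.
  by have [|c Cc hc] := almost_disc rho0 k0 hk (eps := n.+1%:R^-1); [by []|exists c].
have ubox n : box (- r) r (- r) r (u n) by exact/tile_box/C_tile/(hu n).1.
have [U [UU sU]] := @ultraFilterLemma nat \oo eventually_filter.
have PU : ProperFilter U by exact: ultra_proper.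
have [|c1 cv1] := @ultra_cvg_segment nat R U (fun n => (u n).1) (- r) r UU.
  by move=> n; have [] := ubox n; rewrite /= in_itv.
have [|c2 cv2] := @ultra_cvg_segment nat R U (fun n => (u n).2) (- r) r UU.
  by move=> n; have [] := ubox n; rewrite /= !in_itv.
exists (c1, c2), (rho / 2); first by rewrite divr_gt0.
have mM c s : measurable (missing C c s) by exact: measurable_missing.
apply/eqP; rewrite eq_le measure_ge0 andbT; apply/lee_addgt0Pr => e e0.
rewrite add0e.
have rho8 : 0 < rho / 8 by rewrite divr_gt0.
move/cvgrPdist_lt : cv1 => /(_ _ rho8) cv1.
move/cvgrPdist_lt : cv2 => /(_ _ rho8) cv2.
have cv3 : U [set n | n.+1%:R^-1 <= e].
  apply: sU; exists (Num.truncn e^-1) => // n /= hn.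
  have ei0 : 0 < e^-1 by rewrite invr_gt0.
  have /andP[_ eN] := truncn_itv (ltW ei0).
  rewrite -[leRHS]invrK lef_pV2 ?posrE// (le_trans (ltW eN))//.
  by rewrite ler_nat.
have [n [[/= h1 h2] h3]] := filter_ex (filterI (filterI cv1 cv2) cv3).
pose w : plane := (c1 - (u n).1, c2 - (u n).2).
apply: (@le_trans _ _ (n.+1%:R^-1)%:E); last by rewrite lee_fin.
apply: le_trans (hu n).2; rewrite -(lebesgue2_translate w (mM _ rho)).
apply: le_measure; rewrite ?inE//.
  by apply: measurable_translate_preimage; exact: mM.
move=> h [hr nC]; split.
  have := ler_nrm_translate w h.
  have : nrm w < rho / 4 by have := ler_nrm w; rewrite /w/=; lra.
  lra.
move=> Ch; apply: nC; congr C: Ch.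
by rewrite /translate/=; congr (_, _); ring.
Qed.

End invariant_disc.

(** * Discs spread over the tile *)

Section spreading.
Variables (R : realType) (a b : R).
Hypothesis b0 : b != 0.
Local Notation plane := (plane R).
Local Notation leb2 := (@lebesgue2 R).
Local Notation xi := (xi a b).
Local Notation cmul := (cmul a b).
Local Notation cdiv := (cdiv a b).
Local Notation tmap := (tmap a b).
Local Notation beta := (abs_zeta a b).
Hypothesis beta2 : 2 < beta.
(** Dividing by [b ^+ 2], this reads [1 < beta^4 (1 - 1 / b^2)]. *)
Hypothesis b_large : beta ^+ 4 < b ^+ 2 * (beta ^+ 4 - 1).

Variable C : set plane.
Hypotheses (mC : measurable C) (C_tile : C `<=` tile_coords a b).
Hypothesis C_inv : forall z, C z -> C (tmap z).

Let beta0 : 0 < beta. Proof. exact: lt_trans beta2. Qed.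

(** Stated with [negligible], so that inclusions and countable unions apply to arbitrary sets
    [V]. *)
Definition almost_in (V : set plane) := leb2.-negligible (V `\` C).

Lemma almost_inS V W : W `<=` V -> almost_in V -> almost_in W.
Proof. by move=> WV; apply: negligibleS; exact: setSD. Qed.

(** The image of [V] under [tmap], written through the inverse branches [(p + k) / zeta]. *)
Definition step (V : set plane) : set plane :=
  [set p | 0 <= xi p < 1 /\
    exists k : int, V (cdiv (translate (k%:~R, 0) p))].

Lemma measurable_cdiv : measurable_fun setT cdiv.
Proof.
apply: measurable_fun_pair; apply: measurable_funM => //.
  by apply: measurable_funD; exact: measurable_funM.
by apply: measurable_funB; exact: measurable_funM.
Qed.

(** A point of the image outside [C] has, by forward invariance, a preimage in [V] outside [C].
    There are countably many branches, and each preserves null sets. *)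
Lemma almost_in_step V : almost_in V -> almost_in (step V).
Proof.
move=> [N [mN N0 VN]].
pose F (k : int) : set plane := translate (k%:~R, 0) @^-1` (cdiv @^-1` N).
have mF1 : measurable (cdiv @^-1` N).
  by rewrite -[X in measurable X]setTI; exact: measurable_cdiv.
have F0 k : leb2.-negligible (F k).
  exists (F k); split => //; first exact: measurable_translate_preimage.
  rewrite lebesgue2_translate//.
  have := lebesgue2_cmul a b0 mF1; rewrite (_ : cmul @^-1` (cdiv @^-1` N) = N).
    rewrite N0 => /esym/eqP; rewrite mule_eq0 => /orP[|/eqP//].
    by rewrite eqe gt_eqF// invr_gt0 exprn_gt0.
  by apply/seteqP; split => p; rewrite /= cmulK.
pose G n : set plane := if unpickle n is Some k then F k else set0.
apply: (@negligibleS _ _ _ _ (\bigcup_n G n)).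
  move=> p [[xp [k Vk]] nCp]; exists (pickle k) => //.
  rewrite /G pickleK; apply: VN; split => // Ck; apply: nCp.
  rewrite -(@tmapE _ a b p k xp (cdiv (translate (k%:~R, 0) p))); first exact: C_inv.
  by rewrite cdivK// /translate/= addr0.
apply: negligible_bigcup => n; rewrite /G; case: unpickle => //.
exact: negligible_set0.
Qed.

Definition ball_at (c : plane) (rho : R) : set plane :=
  [set p | nrm (translate (- c.1, - c.2) p) < rho].

Lemma missing_almost_in c rho : leb2 (missing C c rho) = 0%E ->
  almost_in (ball_at c rho).
Proof.
move=> M0; have mM := measurable_missing c rho mC.
exists (translate (- c.1, - c.2) @^-1` missing C c rho); split.
- exact: measurable_translate_preimage.
- by rewrite lebesgue2_translate.
- move=> p [bp nC]; split => // Cp; apply: nC; congr C : Cp.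
  by case: p {bp} => x y; case: c {M0 mM} => u v; rewrite /translate/=; congr (_, _); ring.
Qed.

(** The Euclidean width of the strip [0 <= xi < 1], as the gradient of [xi] has length
    [beta / |b|]. *)
Local Notation s := (`|b| / beta).

Let s0 : 0 < s. Proof. by rewrite divr_gt0// normr_gt0. Qed.

(** The normal vector that crosses the strip once: a multiple of [(1, a / b)] with [xi e = 1], hence
    of length [s]. *)
Let e : plane := (b ^+ 2 / beta ^+ 2, a * b / beta ^+ 2).

Let xi_e t : xi (t * e.1, t * e.2) = t.
Proof.
rewrite /xi /e/= sqr_beta//; field.
by rewrite b0 gt_eqF// norm2_gt0.
Qed.

Let nrm_e t : nrm (t * e.1, t * e.2) = `|t| * s.
Proof.
have -> : `|t| * s = Num.sqrt ((`|t| * s) ^+ 2).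
  by rewrite sqrtr_sqr [RHS]ger0_norm// mulr_ge0// ltW.
rewrite /nrm/=; congr Num.sqrt.
have -> : (`|t| * s) ^+ 2 = t ^+ 2 * (b ^+ 2 / beta ^+ 2).
  by rewrite !exprMn exprVn !real_normK ?num_real.
rewrite /e/= sqr_beta//; field.
by rewrite gt_eqF// norm2_gt0.
Qed.

Lemma ler_xi_s p : `|xi p| * s <= nrm p.
Proof.
have := ler_xi_nrm a b0 p; rewrite -(ler_pM2r s0) => /le_trans; apply.
rewrite mulrAC (_ : beta / `|b| * s = 1) ?mul1r//; field.
by rewrite gt_eqF//= normr_eq0.
Qed.

(** The image disc has radius [beta * rho], and an integer shift puts its centre at depth [u] in the
    strip. The first two bounds fit a disc at depth [u + t] into the strip, the third fits it into
    the image disc. *)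
Lemma move_ball c rho t r' : almost_in (ball_at c rho) ->
  let u := frac (xi (cmul c)) in
  r' <= s * (u + t) -> r' <= s * (1 - u - t) -> r' + `|t| * s <= beta * rho ->
  exists2 c', xi c' = u + t & almost_in (ball_at c' r').
Proof.
move=> gb u h1 h2 h3; set k := Num.floor (xi (cmul c)).
pose c' : plane := translate (t * e.1, t * e.2) (translate (- k%:~R, 0) (cmul c)).
have xc' : xi c' = u + t.
  rewrite /c' !xi_translate xi_e /u /frac; congr (_ + _).
  by rewrite {2}/xi/= mulr0 addr0.
exists c' => //; apply: almost_inS (almost_in_step gb) => p pc; split.
  have := ler_xi_s (translate (- c'.1, - c'.2) p) => h.
  have := le_lt_trans h pc; rewrite xi_translate.
  have -> : xi (- c'.1, - c'.2) = - (u + t) by rewrite -xc' /xi/=; ring.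
  set x := xi p => hx.
  have : `|x - (u + t)| * s < s * (u + t) by exact: lt_le_trans h1.
  have : `|x - (u + t)| * s < s * (1 - u - t) by exact: lt_le_trans h2.
  rewrite ![s * _]mulrC !ltr_pM2r// !ltr_norml => /andP[_ hx1] /andP[hx2 _].
  by apply/andP; split; lra.
exists k; rewrite /ball_at/=.
have -> : translate (- c.1, - c.2) (cdiv (translate (k%:~R, 0) p)) =
    cdiv (translate (t * e.1, t * e.2) (translate (- c'.1, - c'.2) p)).
  rewrite -[LHS](cmulK a b0) cmul_translate cdivK//; congr cdiv.
  by rewrite /c' /translate /cmul/=; congr (_, _); ring.
rewrite nrm_cdiv// ltr_pdivrMr// [ltRHS]mulrC (lt_le_trans _ h3)//.
rewrite (le_lt_trans (ler_nrm_translate _ _))// nrm_e ltrD2r.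
exact: pc.
Qed.

(** If the image disc reaches the farther side of the strip, it contains the inscribed disc at depth
    [1 / 2]. Otherwise moving its centre by half its radius towards that side leaves room for a disc
    of radius [beta * rho / 2]. *)
Lemma grow_ball c rho : 0 < rho -> almost_in (ball_at c rho) ->
  (exists2 c', xi c' = 1 / 2 & almost_in (ball_at c' (s / 2))) \/
  (beta * rho < s /\ exists c', almost_in (ball_at c' (beta / 2 * rho))).
Proof.
move=> rho0 gb; have := move_ball gb; set u := frac _ => /= mb.
have := frac_itv (xi (cmul c)); rewrite -/u => /andP[u0 u1].
have br0 : 0 < beta * rho by rewrite mulr_gt0.
have [u2|u2] := leP u (1 / 2).
  have [h|h] := ltP (beta * rho) (s * (1 - u)).
    right; split.
      apply: (lt_le_trans h); rewrite ler_piMr ?(ltW s0)//; lra.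
    pose t := beta * rho / (2 * s).
    have st : s * t = beta * rho / 2 by rewrite /t; field; rewrite gt_eqF//= normr_eq0.
    have t0 : 0 < t by rewrite divr_gt0// mulr_gt0.
    have su : 0 <= s * u by rewrite mulr_ge0// ltW.
    have [||| c' _ gc'] := mb t (beta / 2 * rho).
    - rewrite mulrDr st; lra.
    - have -> : s * (1 - u - t) = s * (1 - u) - s * t by ring.
      by rewrite st; move: h; lra.
    - rewrite (gtr0_norm t0) [t * _]mulrC st; lra.
    by exists c'.
  left; have [||| c' xc' gc'] := mb (1 / 2 - u) (s / 2).
  - by rewrite (_ : u + _ = 1 / 2); [lra|lra].
  - by rewrite (_ : 1 - u - _ = 1 / 2); [lra|lra].
  - have -> : `|1 / 2 - u| = 1 / 2 - u by rewrite ger0_norm//; lra.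
    by rewrite (le_trans _ h)//; lra.
  by exists c' => //; rewrite xc'; lra.
have [h|h] := ltP (beta * rho) (s * u).
  right; split.
    apply: (lt_le_trans h); rewrite ler_piMr ?(ltW s0)//; lra.
  pose t := beta * rho / (2 * s).
  have st : s * t = beta * rho / 2 by rewrite /t; field; rewrite gt_eqF//= normr_eq0.
  have t0 : 0 < t by rewrite divr_gt0// mulr_gt0.
  have su : 0 <= s * (1 - u) by rewrite mulr_ge0 ?(ltW s0)//; lra.
  have [||| c' _ gc'] := mb (- t) (beta / 2 * rho).
  - have -> : s * (u + - t) = s * u - s * t by ring.
    by rewrite st; move: h; lra.
  - have -> : s * (1 - u - - t) = s * (1 - u) + s * t by ring.
    by rewrite st; lra.
  - by rewrite normrN (gtr0_norm t0) [t * _]mulrC st; lra.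
  by exists c'.
left; have [||| c' xc' gc'] := mb (1 / 2 - u) (s / 2).
- by rewrite (_ : u + _ = 1 / 2); [lra|lra].
- by rewrite (_ : 1 - u - _ = 1 / 2); [lra|lra].
- have uN : 1 / 2 - u <= 0 by lra.
  rewrite (ler0_norm uN).
  by rewrite (le_trans _ h)//; lra.
by exists c' => //; rewrite xc'; lra.
Qed.

(** Induction on the number of growth steps by [beta / 2] that bring the radius up to [s]; from
    there the second alternative of [grow_ball], which requires [beta * rho < s], is excluded. *)
Lemma middle_ball c rho : 0 < rho -> almost_in (ball_at c rho) ->
  exists2 c', xi c' = 1 / 2 & almost_in (ball_at c' (s / 2)).
Proof.
have half1 : 1 < beta / 2 by rewrite ltr_pdivlMr// mul1r.
move=> rho0; have [n hn] : exists n, s <= (beta / 2) ^+ n * rho.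
  have q1 : `|2 / beta| < 1 :> R.
    by rewrite ger0_norm ?divr_ge0 ?(ltW beta0)// ltr_pdivrMr ?mul1r.
  have rs0 : 0 < rho / s by rewrite divr_gt0.
  have /cvgrPdist_lt/(_ _ rs0)[N _ hN] := cvg_geometric (1 : R) q1.
  exists N; have := hN N (leqnn N).
  rewrite /geometric/= mul1r sub0r normrN ger0_norm; last first.
    by rewrite exprn_ge0// divr_ge0 ?(ltW beta0).
  rewrite ltr_pdivlMr// => h; apply: ltW.
  rewrite -(@ltr_pM2l _ ((2 / beta) ^+ N)) ?exprn_gt0 ?divr_gt0//.
  rewrite [ltRHS]mulrA -exprMn (_ : 2 / beta * (beta / 2) = 1) ?expr1n ?mul1r//.
  by field; rewrite gt_eqF.
elim: n c rho rho0 hn => [|n ih] c rho rho0 hn gb.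
  have [//|[h _]] := grow_ball rho0 gb.
  move: hn; rewrite expr0 mul1r => hn.
  have : rho <= beta * rho by rewrite ler_peMl ?(ltW rho0)//; lra.
  lra.
have [//|[_ [c' gc']]] := grow_ball rho0 gb.
apply: ih gc'; first by rewrite mulr_gt0 ?divr_gt0.
by rewrite mulrA -exprSr.
Qed.

(** The image disc has radius [beta * s / 2 = |b| / 2] and its centre at height [b / 2]. Rounding to
    the nearest integer makes the horizontal offset at most [1 / 2], which leaves [b^2 / 4 - 1 / 4]
    for the square of the vertical one. *)
Lemma middle_band c : xi c = 1 / 2 -> almost_in (ball_at c (s / 2)) ->
  almost_in [set p | 0 <= xi p < 1 /\
    (p.2 / b - 1 / 2) ^+ 2 < 1 / 4 - 1 / (4 * b ^+ 2)].
Proof.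
move=> xc gb; apply: almost_inS (almost_in_step gb) => p [xp hp]; split => //.
set X := p.1 - (cmul c).1; pose k := - Num.floor (X + 1 / 2).
exists k; rewrite /ball_at/=.
have -> : translate (- c.1, - c.2) (cdiv (translate (k%:~R, 0) p)) =
    cdiv (X + k%:~R, p.2 - (cmul c).2).
  rewrite -[LHS](cmulK a b0) cmul_translate cdivK//; congr cdiv.
  by rewrite /X /translate /cmul/=; congr (_, _); ring.
rewrite nrm_cdiv// ltr_pdivrMr// mulrAC divfK ?gt_eqF//.
rewrite -[ltRHS]ger0_norm ?divr_ge0// -sqrtr_sqr /nrm/=.
have Xk : (X + k%:~R) ^+ 2 <= 1 / 4.
  have := frac_itv (X + 1 / 2); rewrite /frac /k intrN => h.
  have : 0 <= (1 / 2 - (X - (Num.floor (X + 1 / 2))%:~R)) * (1 / 2 + (X - (Num.floor (X + 1 / 2))%:~R)).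
    by apply: mulr_ge0; lra.
  lra.
have c2 : (cmul c).2 / b = 1 / 2.
  by rewrite -xc -(@snd_tmap _ a b b0).
have Yk : (p.2 - (cmul c).2) ^+ 2 < b ^+ 2 / 4 - 1 / 4.
  have -> : p.2 - (cmul c).2 = b * (p.2 / b - 1 / 2) by rewrite -c2; field.
  have b2 : 0 < b ^+ 2 by rewrite exprn_even_gt0.
  rewrite exprMn; move: hp; rewrite -(ltr_pM2l b2) => /lt_le_trans; apply.
  by rewrite le_eqVlt; apply/orP; left; apply/eqP; field.
rewrite ltr_sqrt; last by rewrite exprn_even_gt0//= mulf_neq0 ?normr_eq0.
rewrite exprMn real_normK ?num_real//; move: Yk; rewrite /cmul/=; lra.
Qed.

(** The preimages [(p + k) / zeta] of a tile point have second tile coordinates spaced by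
    [1 / beta^2], so one is within [1 / (2 beta^2)] of [1 / 2]. By [b_large], such a preimage lies
    in the band. *)
Lemma full_tile : almost_in [set p | 0 <= xi p < 1 /\
    (p.2 / b - 1 / 2) ^+ 2 < 1 / 4 - 1 / (4 * b ^+ 2)] ->
  almost_in (tile_coords a b).
Proof.
move=> gb; apply: almost_inS (almost_in_step gb) => p [xp yp]; split => //.
set Y := a / b * p.2 - p.1; set k := Num.floor (Y - beta ^+ 2 / 2 + 1 / 2).
have N0 := norm2_gt0 a b0.
exists k; split.
  have -> : xi (cdiv (translate (k%:~R, 0) p)) = p.2 / b; last by [].
  by rewrite -(@snd_tmap _ a b b0) /tmap cdivK//= /translate/= addr0.
have -> : (cdiv (translate (k%:~R, 0) p)).2 / b - 1 / 2 =
    (Y - beta ^+ 2 / 2 - k%:~R) / beta ^+ 2.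
  rewrite sqr_beta// /cdiv /translate /Y/=; field.
  by rewrite b0 gt_eqF.
have Yk : (Y - beta ^+ 2 / 2 - k%:~R) ^+ 2 <= 1 / 4.
  have := frac_itv (Y - beta ^+ 2 / 2 + 1 / 2); rewrite /frac -/k => h.
  set z := Y - _ - _; have z1 : - (1 / 2) <= z < 1 / 2 by rewrite /z; lra.
  have : 0 <= (1 / 2 - z) * (1 / 2 + z) by apply: mulr_ge0; lra.
  lra.
rewrite expr_div_n -exprM ltr_pdivrMr ?exprn_gt0//.
apply: (le_lt_trans Yk).
have b2 : 0 < b ^+ 2 by rewrite exprn_even_gt0.
rewrite (_ : (1 / 4 - 1 / (4 * b ^+ 2)) * beta ^+ (2 * 2) =
  (b ^+ 2 * beta ^+ 4 - beta ^+ 4) / (4 * b ^+ 2)); last by field.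
have b4 : 0 < 4 * b ^+ 2 by lra.
rewrite ltr_pdivlMr//; move: b_large.
by set B := beta ^+ 4; set c := b ^+ 2; lra.
Qed.

Lemma invariant_set_full : (0 < leb2 C)%E ->
  leb2 (tile_coords a b `\` C) = 0%E.
Proof.
move=> C_gt0.
have [c [rho rho0 /missing_almost_in gb]] :=
  invariant_set_disc b0 beta2 mC C_tile C_inv C_gt0.
have [c' xc' /(middle_band xc')/full_tile gt] := middle_ball rho0 gb.
apply: measure_negligible gt; apply: measurableD => //.
exact: measurable_tile_coords.
Qed.

End spreading.

(** * Equivalence and uniqueness *)

Section uniqueness.
Variables (R : realType) (a b : R).
Hypothesis b0 : b != 0.
Local Notation plane := (plane R).
Local Notation leb2 := (@lebesgue2 R).
Local Notation tmap := (tmap a b).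
Local Notation X := (tile_coords a b).
Local Notation beta := (abs_zeta a b).
Hypothesis beta2 : 2 < beta.
Hypothesis b_large : beta ^+ 4 < b ^+ 2 * (beta ^+ 4 - 1).

Let mT A : measurable A -> measurable (tmap @^-1` A).
Proof. by move=> mA; rewrite -[Y in measurable Y]setTI; exact: measurable_tmap. Qed.

Let mX : measurable X. Proof. exact: measurable_tile_coords. Qed.

(** Let [U] be the union of all iterated preimages of [N]; it is [mu]-null, so the forward invariant
    set [X \ U] has positive area. It is then full in [X], and it is disjoint from [N]. Arbitrary
    measures are allowed so that a Jordan part can be inserted. *)
Lemma invariant_measure_null (mu : {measure set plane -> \bar R}) (N : set plane) :
  mu X != 0%E ->
  (forall A, measurable A -> mu (tmap @^-1` A) = mu A) ->
  (forall A, measurable A -> leb2 A = 0%E -> mu A = 0%E) ->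
  measurable N -> mu N = 0%E -> leb2 (X `&` N) = 0%E.
Proof.
move=> muX mu_inv mu_ac mN N0.
have mi n A : measurable A -> measurable (iter n tmap @^-1` A).
  by move=> mA; rewrite -[Y in measurable Y]setTI; exact: measurable_iter_tmap.
have iN n : mu (iter n tmap @^-1` N) = 0%E.
  elim: n => [|n ih]; first exact: N0.
  rewrite -ih -[RHS]mu_inv//; last exact: mi.
  by congr (mu _); apply/funext => z; congr N; exact: iterSr.
pose U := \bigcup_n (iter n tmap @^-1` N).
have mU : measurable U by apply: bigcupT_measurable => n; exact: mi.
have U0 : mu U = 0%E.
  apply: measure_negligible => //; apply: negligible_bigcup => n.
  by exists (iter n tmap @^-1` N); split => //; exact: mi.
have mC : measurable (X `\` U) by exact: measurableD.
have C_inv z : (X `\` U) z -> (X `\` U) (tmap z).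
  move=> [Xz nUz]; split; first by apply: tmap_tile => //; case: Xz.
  by move=> [n _ Nn]; apply: nUz; exists n.+1 => //=; rewrite -iterS iterSr.
have C_gt0 : (0 < leb2 (X `\` U))%E.
  rewrite lt0e measure_ge0 andbT; apply/negP => /eqP C0.
  move/negP : muX; apply; rewrite -measure_le0.
  apply: (@le_trans _ _ (mu ((X `\` U) `|` U))).
    apply: le_measure; rewrite ?inE//; first exact: measurableU.
    by move=> z Xz; have [?|?] := pselect (U z); [right|left].
  apply: (le_trans (measureU2 _ mC mU)).
  by rewrite [Y in (Y + _)%E]mu_ac// [Y in (_ + Y)%E]U0 adde0.
have := invariant_set_full b0 beta2 b_large mC (@subDsetl _ _ _) C_inv C_gt0.
apply: subset_measure0.
- exact: measurableI.
- exact: measurableD.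
- by move=> z [Xz Nz]; split => // -[_ ]; apply; exists 0%N.
Qed.

Definition acim (P : probability plane R) :=
  [/\ P X = 1%E, forall A, measurable A -> P (tmap @^-1` A) = P A &
      forall A, measurable A -> leb2 A = 0%E -> P A = 0%E].

Lemma acim_tileI (P : probability plane R) A : P X = 1%E -> measurable A ->
  P (A `&` X) = P A.
Proof.
move=> PX mA; apply/eqP; rewrite eq_le; apply/andP; split.
  by apply: le_measure; rewrite ?inE//; exact: measurableI.
have mC := measurableC mX; have mI := measurableI _ _ mA mX.
apply: (@le_trans _ _ (P ((A `&` X) `|` ~` X))).
  apply: le_measure; rewrite ?inE//; first exact: measurableU.
  by move=> z Az; have [?|?] := pselect (X z); [left|right].
apply: (le_trans (measureU2 _ mI mC)).
by rewrite [Y in (_ + Y)%E]probability_setC// PX subee// adde0.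
Qed.

(** Take the Hahn decomposition of [P - Q]. Its positive part is invariant, absolutely continuous
    and null on the negative set [n]. Were it nonzero, [X] would meet [n] in a set of area 0, so
    [d n = 0]; as the total charge is 0, also [d p = 0], a contradiction. *)
Lemma acim_unique (P Q : probability plane R) : acim P -> acim Q ->
  forall A, measurable A -> P A = Q A.
Proof.
move=> [PX P_inv P_ac] [QX Q_inv Q_ac].
pose nu : {charge set plane -> \bar R} :=
  cadd (charge_of_finite_measure P) (cscale (-1) (charge_of_finite_measure Q)).
pose d A : R := fine (P A) - fine (Q A).
have nuE A : measurable A -> nu A = (d A)%:E.
  move=> mA; rewrite /nu /= /cadd/= /cscale/= EFinB.
  by rewrite !probability_fineK// mulN1e.
have pP := probability_content P; have pQ := probability_content Q.
have dU A B : measurable A -> measurable B -> A `&` B = set0 ->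
    d (A `|` B) = d A + d B.
  move=> mA mB AB; case: pP => _ _ UP; case: pQ => _ _ UQ.
  by rewrite /d UP// UQ//; ring.
have dT : d setT = 0 by rewrite /d !probability_setT subrr.
have d_inv A : measurable A -> d (tmap @^-1` A) = d A.
  by move=> mA; rewrite /d P_inv// Q_inv.
have d0 A : measurable A -> leb2 A = 0%E -> d A = 0.
  by move=> mA A0; rewrite /d P_ac// Q_ac// subrr.
have dX : forall A, measurable A -> d (A `&` X) = d A.
  by move=> A mA; rewrite /d !acim_tileI.
have PQd A : measurable A -> d A = 0 -> P A = Q A.
  move=> mA /eqP; rewrite subr_eq0 => /eqP PQ.
  by rewrite -(probability_fineK P)// -(probability_fineK Q)// PQ.
clearbody d.
have [p [n nuPN]] := Hahn_decomposition nu.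
have [[mp pos_p] [mn neg_n] pn_T pn_0] := nuPN.
have dp A : measurable A -> A `<=` p -> 0 <= d A.
  by move=> mA Ap; have := pos_p A mA Ap; rewrite nuE.
have dn A : measurable A -> A `<=` n -> d A <= 0.
  by move=> mA An; have := neg_n A mA An; rewrite nuE.
have nE z : ~ p z -> n z.
  by move=> npz; have [|] : (p `|` n) z by rewrite pn_T.
have dI A B : measurable A -> measurable B -> d A = d (A `&` B) + d (A `\` B).
  move=> mA mB; rewrite -dU ?setUIDK//; [exact: measurableI|exact: measurableD|].
  by apply/seteqP; split => // z [[_ Bz] [_ nBz]].
have d_sub0 A B : measurable A -> measurable B -> A `<=` B -> B `<=` p ->
    d B = 0 -> d A = 0.
  move=> mA mB AB Bp B0; apply/eqP; rewrite eq_le; apply/andP; split.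
    have := dI B A mB mA; rewrite (setIidr AB) B0.
    have := dp (B `\` A) (measurableD mB mA) (subset_trans (@subDsetl _ _ _) Bp).
    lra.
  by apply: dp => //; exact: subset_trans Bp.
have d_sub0n A B : measurable A -> measurable B -> A `<=` B -> B `<=` n ->
    d B = 0 -> d A = 0.
  move=> mA mB AB Bn B0; apply/eqP; rewrite eq_le; apply/andP; split.
    by apply: dn => //; exact: subset_trans Bn.
  have := dI B A mB mA; rewrite (setIidr AB) B0.
  have := dn (B `\` A) (measurableD mB mA) (subset_trans (@subDsetl _ _ _) Bn).
  lra.
have mtp := mT mp.
have mE := measurableD mtp mp; have mF := measurableD mp mtp.
have Fp : p `\` tmap @^-1` p `<=` p by exact: subDsetl.
have En : tmap @^-1` p `\` p `<=` n by move=> z [_ /nE].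
(* Invariance of the charge of [p] makes these two charges equal, while the first is nonpositive and
   the second nonnegative. *)
have [E0 F0] : d (tmap @^-1` p `\` p) = 0 /\ d (p `\` tmap @^-1` p) = 0.
  have := dI _ _ mtp mp; have := dI _ _ mp mtp; rewrite d_inv// setIC.
  by have := dp _ mF Fp; have := dn _ mE En; lra.
have s_inv A : measurable A -> d (tmap @^-1` A `&` p) = d (A `&` p).
  move=> mA; have mtA := mT mA.
  rewrite -[RHS]d_inv; last exact: measurableI.
  rewrite preimage_setI.
  have m1 : measurable (tmap @^-1` A `&` p) by exact: measurableI.
  have m2 : measurable (tmap @^-1` A `&` tmap @^-1` p) by exact: measurableI.
  have z1 : d ((tmap @^-1` A `&` p) `\` tmap @^-1` p) = 0.
    apply: (@d_sub0 _ (p `\` tmap @^-1` p)) => //; first exact: measurableD.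
    by move=> z [[_ ?] ?].
  have z2 : d ((tmap @^-1` A `&` tmap @^-1` p) `\` p) = 0.
    apply: (@d_sub0n _ (tmap @^-1` p `\` p)) => //; first exact: measurableD.
    by move=> z [[_ ?] ?].
  by rewrite (dI _ _ m1 mtp) (dI _ _ m2 mp) z1 z2 setIAC.
pose sg : {measure set plane -> \bar R} := jordan_pos nuPN.
have sgE A : measurable A -> sg A = (d (A `&` p))%:E.
  move=> mA; transitivity (crestr0 nu mp A); first by [].
  by rewrite /crestr0 mem_set// /crestr nuE//; exact: measurableI.
have dp0 : d p = 0.
  apply: contrapT => dp_neq0.
  have Xn0 : leb2 (X `&` n) = 0%E.
    apply: (@invariant_measure_null sg) => //.
    - by rewrite sgE// setIC dX// eqe; apply/eqP.
    - by move=> A mA; rewrite !sgE ?s_inv//; exact: mT.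
    - move=> A mA A0; rewrite sgE// d0//; first exact: measurableI.
      by apply: subset_measure0 A0 => //; exact: measurableI.
    - by rewrite sgE// setIC pn_0 d0// measure0.
  apply: dp_neq0; have := dU _ _ mp mn pn_0; rewrite pn_T dT.
  by rewrite -[d n]dX// setIC (d0 _ (measurableI _ _ mX mn) Xn0) addr0.
have dn0 : d n = 0 by have := dU _ _ mp mn pn_0; rewrite pn_T dT dp0; lra.
move=> A mA; apply: PQd => //.
rewrite (dI A p)// (@d_sub0 (A `&` p) p)//; last exact: measurableI.
rewrite (@d_sub0n (A `\` p) n)// ?addr0//; first exact: measurableD.
by move=> z [_ /nE].
Qed.

End uniqueness.

(** * Back to the complex plane *)

Section complex_coordinates.
Variables (R : realType) (a b : R).
Hypothesis b0 : b != 0.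
Local Notation plane := (plane R).
Local Notation zeta := (a +i* b).

Lemma in_plane_tile : in_plane (tile zeta) = tile_coords a b.
Proof.
apply/seteqP; split => -[u v].
  move=> [x [y [x01 y01]]]; rewrite tile_coord /complex_of_plane/=.
  move=> /eqP; rewrite eq_complex/= => /andP[/eqP uE /eqP vE].
  rewrite /tile_coords /xi /= uE vE.
  have -> : x - a * y + a / b * (b * y) = x by field.
  by have -> : b * y / b = y by field.
rewrite /tile_coords/= => -[x01 y01].
exists (xi a b (u, v)), (v / b); split => //; rewrite tile_coord /complex_of_plane/=.
apply/eqP; rewrite eq_complex/= /xi/=.
by apply/andP; split; apply/eqP; field.
Qed.

(** Digits are unique, so it is enough that the integer [floor (ell a b p)] is admissible, which
    [tmap_tile] provides. *)
Lemma rotational_beta_tmap (p : plane) : tile_coords a b p ->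
  rotational_beta zeta (complex_of_plane p) = complex_of_plane (tmap a b p).
Proof.
move=> Xp; set z := complex_of_plane p.
have mulE : zeta * z = complex_of_plane (cmul a b p).
  apply/eqP; rewrite eq_complex /z /complex_of_plane /cmul/=.
  by apply/andP; split; apply/eqP; ring.
pose l : R[i] := (Num.floor (ell a b p))%:~R%:C.
have subE : zeta * z - l = complex_of_plane (tmap a b p).
  rewrite mulE /l /tmap /complex_of_plane/=.
  by apply/eqP; rewrite eq_complex/=; apply/andP; split; apply/eqP; ring.
have l_ok : lattice zeta l /\ tile zeta (zeta * z - l).
  split.
    exists (Num.floor (ell a b p)), 0.
    by rewrite mulr0 addr0 /l rmorph_int.
  rewrite subE; have : tile_coords a b (tmap a b p) by apply: tmap_tile => //; case: Xp.
  by rewrite -in_plane_tile.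
have [l' [_ l'_uniq]] := @digit_unique R zeta z b0.
have [d_lat d_tile] := @digitP R zeta z b0.
rewrite /rotational_beta -subE; congr (_ - _).
by rewrite -(l'_uniq _ (conj d_lat d_tile)) (l'_uniq _ l_ok).
Qed.

Lemma is_ACIM_acim (mu : probability plane R) :
  is_ACIM zeta mu <-> acim a b mu.
Proof.
have mX := measurable_tile_coords a b.
have mT A : measurable A -> measurable (tmap a b @^-1` A).
  by move=> mA; rewrite -[Y in measurable Y]setTI; exact: measurable_tmap.
have preE (A : set R[i]) :
    in_plane (tile zeta `&` rotational_beta zeta @^-1` A) =
    tile_coords a b `&` tmap a b @^-1` in_plane A.
  have tE p : tile zeta (complex_of_plane p) = tile_coords a b p.
    by rewrite -in_plane_tile.
  apply/seteqP; split => p [Xp]; rewrite /preimage/=.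
    by rewrite tE in Xp; rewrite rotational_beta_tmap// /in_plane.
  by rewrite /in_plane/= tE -rotational_beta_tmap.
split=> [[muX mu_inv mu_ac]|[muX mu_inv mu_ac]].
  rewrite in_plane_tile in muX; split => //.
    move=> A mA; have mI := measurableI _ _ mA mX.
    (* [is_ACIM] tests only complex subsets of the tile, so [A] is first cut down to the tile; this
       changes no [mu]-mass. *)
    pose A' : set R[i] := [set z | (A `&` tile_coords a b) (complex.Re z, complex.Im z)].
    have A'E : in_plane A' = A `&` tile_coords a b.
      by apply/seteqP; split => -[].
    rewrite -(acim_tileI muX (mT _ mA)) -(acim_tileI muX mA) -A'E.
    rewrite -mu_inv; last 2 first.
    - move=> [x y] [_ Xp].
      by have : in_plane (tile zeta) (x, y) by rewrite in_plane_tile.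
    - by rewrite A'E.
    rewrite preE A'E; congr (mu _); apply/seteqP; split => p.
      by move=> [TA Xp]; split => //; split => //; apply: tmap_tile => //; case: Xp.
    by move=> [Xp [TA _]].
  by move/null_content_dominatesP : mu_ac.
split.
- by rewrite in_plane_tile.
- move=> A A_tile mA; rewrite preE setIC acim_tileI ?mu_inv//; exact: mT.
- by apply/null_content_dominatesP.
Qed.

Lemma dominates_lebesgue_tile (mu : probability plane R) : is_ACIM zeta mu ->
  mu `<< lebesgue_tile zeta.
Proof.
move=> /is_ACIM_acim[muX _ mu_ac] A A0 B mB BA.
have mX := measurable_tile_coords a b.
rewrite -(acim_tileI muX mB); apply: mu_ac; first exact: measurableI.
by have := A0 B mB BA; rewrite /lebesgue_tile in_plane_tile.
Qed.

Lemma lebesgue_tile_dominates (mu : probability plane R) :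
  2 < abs_zeta a b ->
  abs_zeta a b ^+ 4 < b ^+ 2 * (abs_zeta a b ^+ 4 - 1) ->
  is_ACIM zeta mu -> lebesgue_tile zeta `<< mu.
Proof.
move=> beta2 b_large /is_ACIM_acim[muX mu_inv mu_ac] A A0 B mB BA.
rewrite /lebesgue_tile in_plane_tile setIC.
apply: (invariant_measure_null b0 beta2 b_large) (A0 B mB BA) => //.
by apply/eqP; rewrite [LHS]muX; apply/eqP; exact: oner_neq0.
Qed.

End complex_coordinates.

(** Here [sin^2 theta = b^2 / beta^2], so squaring the bound on [beta] gives [q < 2 b^2 - 1] for the
    inner root [q]. Squaring again gives [b^2 / beta^4 < b^2 - 1], a rearrangement of the
    conclusion. *)
Lemma Cbound_lt (R : realType) (a b : R) : b != 0 ->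
  Cbound (angle 1 (- conjc (a +i* b))) < abs_zeta a b ->
  abs_zeta a b ^+ 4 < b ^+ 2 * (abs_zeta a b ^+ 4 - 1).
Proof.
move=> b0; set beta := abs_zeta a b.
have beta0 : 0 < beta := beta_gt0 a b0.
have betaE : beta ^+ 2 = a ^+ 2 + b ^+ 2 := sqr_beta a b0.
have -> : angle 1 (- conjc (a +i* b)) = acos (- a / beta).
  rewrite /angle !normc_def /= !mul1r !mul0r addr0.
  by rewrite !expr1n expr0n/= addr0 sqrtr1 mul1r sqrrN opprK.
rewrite /Cbound; set s := sin _.
have s2 : s ^+ 2 = b ^+ 2 / beta ^+ 2.
  have le1 : `|- a / beta| <= 1.
    rewrite -[leRHS]sqrtr1; apply: ler_abs_sqrt.
    rewrite expr_div_n sqrrN betaE ler_pdivrMr ?norm2_gt0// mul1r.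
    by rewrite lerDl sqr_ge0.
  have : - 1 <= - a / beta <= 1 by rewrite -ler_norml.
  move=> /sin_acos; rewrite -/s => ->; rewrite sqr_sqrtr.
    rewrite exprMn sqrrN exprVn betaE; field.
    by rewrite gt_eqF// norm2_gt0.
  by rewrite subr_ge0 -[leLHS]real_normK ?num_real// expr_le1.
have b2 : 0 < b ^+ 2 by rewrite exprn_even_gt0.
have bb2 : 0 < beta ^+ 2 by rewrite exprn_gt0.
have s20 : 0 < s ^+ 2 by rewrite s2 divr_gt0.
set q := Num.sqrt (1 + _) => h.
have h1 : (1 + q) / (2 * s ^+ 2) < beta ^+ 2.
  rewrite ltNge; apply/negP => le; move: h; rewrite ltNge => /negP; apply.
  by rewrite -[leLHS](ger0_norm (ltW beta0)) -sqrtr_sqr ler_wsqrtr.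
have h2 : q < 2 * b ^+ 2 - 1.
  have s22 : 0 < 2 * s ^+ 2 by lra.
  move: h1; rewrite ltr_pdivrMr// s2.
  have -> : beta ^+ 2 * (2 * (b ^+ 2 / beta ^+ 2)) = 2 * b ^+ 2.
    by field; rewrite gt_eqF.
  lra.
have q0 : 0 <= q by exact: sqrtr_ge0.
have h3 : q ^+ 2 < (2 * b ^+ 2 - 1) ^+ 2.
  by rewrite ltr_pXn2r ?nnegrE//; lra.
have q2 : q ^+ 2 = 1 + 4 * (s ^+ 2) ^+ 2.
  rewrite sqr_sqrtr; first by rewrite -exprM.
  by rewrite addr_ge0// mulr_ge0// exprn_even_ge0.
have h4 : (b ^+ 2 / beta ^+ 2) ^+ 2 < b ^+ 2 * (b ^+ 2 - 1).
  by move: h3; rewrite q2 s2; lra.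
have b4 : 0 < beta ^+ 4 by rewrite exprn_gt0.
have : b ^+ 2 / beta ^+ 4 < b ^+ 2 - 1.
  rewrite -(ltr_pM2l b2) (le_lt_trans _ h4)// le_eqVlt; apply/orP; left.
  by apply/eqP; field; rewrite gt_eqF.
rewrite ltr_pdivrMr//; lra.
Qed.

Theorem corollary1p5 (R : realType) (beta : R) (zeta : R[i]) (theta : R)
  (hbeta : 1 < beta) (hzeta : complex.Im zeta != 0) (hnorm : `|zeta| = beta%:C)
  (htheta : theta = angle 1 (- conjc zeta)) (htheta_itv : 0 < theta < pi)
  (hbound : Num.max 2 (Cbound theta) < beta) :
  exists mu : probability (plane R) R,
    [/\ is_ACIM zeta mu,
        forall nu : probability (plane R) R, is_ACIM zeta nu ->
          forall A : set (plane R), measurable A -> nu A = mu A,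
        mu `<< lebesgue_tile zeta
      & lebesgue_tile zeta `<< mu].
Proof.
case: zeta hzeta hnorm htheta => a b /= b0 hnorm htheta.
have betaE : beta = abs_zeta a b.
  by move: hnorm; rewrite normc_def => -[<-].
move: hbound; rewrite gt_max htheta betaE => /andP[beta2 /(Cbound_lt b0) b_large].
have [mu mu_acim] := exists_acim b0 beta2.
have mu_ACIM : is_ACIM (a +i* b) mu by exact/(@is_ACIM_acim _ a b b0).
exists mu; split => //.
- move=> nu /(@is_ACIM_acim _ a b b0) nu_acim.
  exact: (acim_unique b0 beta2 b_large).
- exact: dominates_lebesgue_tile.
- exact: lebesgue_tile_dominates.
Qed.
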